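(* Let $R$ be a left coherent ring. Any weakly Ding injective complex of $R$-modules is equal to a direct sum $L \oplus B$ with $L$ a Ding injective complex and $B$ an FP-injective complex.
   Context: Modules are left $R$-modules; $\mathrm{Ch}(R)$ is the category of chain complexes of $R$-modules, $\mathrm{Hom}$ is the group of chain maps, and $\mathrm{Ext}^1$ is the Yoneda Ext of the abelian category $\mathrm{Ch}(R)$. A complex $A$ is FP-injective if $\mathrm{Ext}^1(F,A)=0$ for all finitely presented complexes $F$; over a left coherent ring, equivalently, $A$ is exact with every cycle module $Z_nA$ FP-injective (a module $N$ is FP-injective if $\mathrm{Ext}^1_R(F,N)=0$ for all finitely presented modules $F$). A complex $G$ is weakly Ding injective if $G=Z_0\mathbb{E}$ for an exact complex $\mathbb{E}$ of FP-injective complexes such that $\mathrm{Hom}(A,\mathbb{E})$ is exact for every FP-injective complex $A$; it is Ding injective if moreover $\mathbb{E}$ can be taken to be an exact complex of injective complexes with this property. *)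

(* Defs.v *)
From HB Require Import structures.
From mathcomp Require Import all_boot all_order all_algebra.
Set Implicit Arguments.
Unset Strict Implicit.
Unset Printing Implicit Defensive.
Import GRing.Theory.
Local Open Scope ring_scope.

(* The type of [x : U] with [f x = 0], as an R-module. *)
Section Kernel.
Context {R : pzRingType} {U V : lmodType R} (f : {linear U -> V}).

Definition ker_pred : {pred U} := [pred x | f x == 0].

Lemma ker_pred_submod : GRing.submod_closed ker_pred.
Proof.
split=> [|a x y]; rewrite !inE; first by rewrite linear0.
by move=> /eqP fx /eqP fy; rewrite linearP fx fy scaler0 addr0.
Qed.
HB.instance Definition _ :=
  GRing.isSubmodClosed.Build R U ker_pred ker_pred_submod.

Record kernel : Type := Kernel {kval :> U; kvalP : kval \in ker_pred}.
HB.instance Definition _ := [isSub for kval].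
HB.instance Definition _ := [Choice of kernel by <:].
HB.instance Definition _ := [SubChoice_isSubLmodule of kernel by <:].
End Kernel.

Section Modules.
Context {R : pzRingType}.

Definition finitely_generated_module (M : lmodType R) : Prop :=
  exists (k : nat) (p : {linear 'rV[R]_k -> M}), forall x, exists v, p v = x.

Definition finitely_presented_module (M : lmodType R) : Prop :=
  exists (m k : nat) (q : {linear 'rV[R]_m -> 'rV[R]_k})
         (p : {linear 'rV[R]_k -> M}),
    (forall x, exists v, p v = x) /\
    (forall v, p v = 0 <-> exists w, q w = v).
End Modules.

(* A left ideal of R is a module J with an injective linear map to R^o. *)
Definition left_coherent (R : pzRingType) : Prop :=
  forall (J : lmodType R) (i : {linear J -> R^o}),
    injective i -> finitely_generated_module J -> finitely_presented_module J.

(* Homological grading; the differential d_n goes from degree n to n - 1, so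
   that no transport along equalities of degrees is needed. *)
Record complex (R : pzRingType) : Type := Complex {
  cobj :> int -> lmodType R;
  cdiff : forall n : int, {linear cobj n -> cobj (n - 1)};
  cdiffK : forall (n : int) (x : cobj n), cdiff (n - 1) (cdiff n x) = 0
}.

Arguments cdiff {R c} n.

Record chain_map (R : pzRingType) (X Y : complex R) : Type := ChainMap {
  cmap :> forall n : int, {linear X n -> Y n};
  cmapP : forall (n : int) (x : X n),
    cmap (n - 1) (cdiff n x) = cdiff n (cmap n x)
}.

Section ChainMaps.
Context {R : pzRingType}.
Implicit Types X Y Z : complex R.

Definition mono X Y (f : chain_map X Y) : Prop :=
  forall n, injective (f n).

Definition epi X Y (f : chain_map X Y) : Prop :=
  forall n (y : Y n), exists x : X n, f n x = y.

Definition exact_at X Y Z (f : chain_map X Y) (g : chain_map Y Z) : Prop :=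
  forall n (y : Y n), g n y = 0 <-> exists x : X n, f n x = y.

Definition cplx_iso X Y : Prop :=
  exists (f : chain_map X Y) (g : chain_map Y X),
    (forall n x, g n (f n x) = x) /\ (forall n y, f n (g n y) = y).
End ChainMaps.

Section KernelComplex.
Context {R : pzRingType} {X Y : complex R} (f : chain_map X Y).

Lemma ker_diff_subproof n (x : kernel (f n)) :
  cdiff n (kval x) \in ker_pred (f (n - 1)).
Proof. by have /eqP fx := kvalP x; rewrite inE cmapP fx linear0. Qed.

Definition ker_diff n (x : kernel (f n)) : kernel (f (n - 1)) :=
  Kernel (ker_diff_subproof x).

Lemma ker_diff_linear n : linear (@ker_diff n).
Proof. by move=> a x y; apply: val_inj; rewrite /= linearP. Qed.
HB.instance Definition _ n :=
  GRing.isLinear.Build R _ _ _ (@ker_diff n) (@ker_diff_linear n).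

Lemma ker_diffK n (x : kernel (f n)) : ker_diff (ker_diff x) = 0.
Proof. by apply: val_inj; rewrite /= cdiffK. Qed.

Definition ker_complex : complex R :=
  @Complex R (fun n => kernel (f n)) (fun n => @ker_diff n) ker_diffK.
End KernelComplex.

Section DirectSum.
Context {R : pzRingType} (X Y : complex R).

Definition dsum_diff n (u : X n * Y n) : X (n - 1) * Y (n - 1) :=
  (cdiff n u.1, cdiff n u.2).

Lemma dsum_diff_linear n : linear (@dsum_diff n).
Proof. by move=> a u v; rewrite /dsum_diff /= !linearP. Qed.
HB.instance Definition _ n :=
  GRing.isLinear.Build R _ _ _ (@dsum_diff n) (@dsum_diff_linear n).

Lemma dsum_diffK n (u : X n * Y n) : dsum_diff (dsum_diff u) = 0.
Proof. by rewrite /dsum_diff /= !cdiffK. Qed.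

Definition dsum : complex R :=
  @Complex R (fun n => X n * Y n)%type (fun n => @dsum_diff n) dsum_diffK.

Definition dsum_inl_fun n (x : X n) : dsum n := (x, 0).
Lemma dsum_inl_linear n : linear (@dsum_inl_fun n).
Proof. by move=> a x y; congr pair; rewrite /= scaler0 addr0. Qed.
HB.instance Definition _ n :=
  GRing.isLinear.Build R _ _ _ (@dsum_inl_fun n) (@dsum_inl_linear n).
Lemma dsum_inlP n (x : X n) :
  dsum_inl_fun (cdiff n x) = cdiff n (dsum_inl_fun x).
Proof. by congr pair; rewrite /= linear0. Qed.
Definition dsum_inl : chain_map X dsum :=
  @ChainMap R X dsum (fun n => @dsum_inl_fun n) dsum_inlP.

Definition dsum_snd_fun n (u : dsum n) : Y n := u.2.
Lemma dsum_snd_linear n : linear (@dsum_snd_fun n).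
Proof. by []. Qed.
HB.instance Definition _ n :=
  GRing.isLinear.Build R _ _ _ (@dsum_snd_fun n) (@dsum_snd_linear n).
Lemma dsum_sndP n (u : dsum n) :
  dsum_snd_fun (cdiff n u) = cdiff n (dsum_snd_fun u).
Proof. by []. Qed.
Definition dsum_snd : chain_map dsum Y :=
  @ChainMap R dsum Y (fun n => @dsum_snd_fun n) dsum_sndP.

Lemma dsum_inl_mono : mono dsum_inl.
Proof. by move=> n x y []. Qed.
Lemma dsum_snd_epi : epi dsum_snd.
Proof. by move=> n y; exists (0, y). Qed.
Lemma dsum_exact : exact_at dsum_inl dsum_snd.
Proof.
move=> n [x y]; split=> [y0 | [z [_ y0]]]; last by symmetry.
by exists x; congr pair; symmetry.
Qed.
End DirectSum.

(* Yoneda Ext^1: short exact sequences 0 -> A -> M -> C -> 0 up to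
   equivalence.  The zero class is that of the split sequence. *)
Record extension (R : pzRingType) (C A : complex R) : Type := Extension {
  ext_mid : complex R;
  ext_in : chain_map A ext_mid;
  ext_out : chain_map ext_mid C;
  ext_in_mono : mono ext_in;
  ext_out_epi : epi ext_out;
  ext_exact : exact_at ext_in ext_out
}.

Definition split_extension (R : pzRingType) (C A : complex R) :
    extension C A :=
  Extension (@dsum_inl_mono R A C) (@dsum_snd_epi R A C) (@dsum_exact R A C).

(* The comparison map is automatically an isomorphism, by the five lemma. *)
Definition yoneda_equiv (R : pzRingType) (C A : complex R)
    (S T : extension C A) : Prop :=
  exists h : chain_map (ext_mid S) (ext_mid T),
    (forall n (a : A n), h n (ext_in S n a) = ext_in T n a) /\
    (forall n (x : ext_mid S n), ext_out T n (h n x) = ext_out S n x).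

Definition Ext1_zero (R : pzRingType) (C A : complex R) : Prop :=
  forall S : extension C A, yoneda_equiv S (split_extension C A).

Section Complexes.
Context {R : pzRingType}.
Implicit Types X F A G I : complex R.

Record is_subcomplex X (S : forall n, X n -> Prop) : Prop := IsSubcomplex {
  sub_zero : forall n, S n 0;
  sub_add : forall n x y, S n x -> S n y -> S n (x + y);
  sub_scale : forall n a x, S n x -> S n (a *: x);
  sub_diff : forall n x, S n x -> S (n - 1) (cdiff n x)
}.

(* Generated, as a complex, by finitely many homogeneous elements. *)
Definition finitely_generated X : Prop :=
  exists (k : nat) (deg : 'I_k -> int) (g : forall i, X (deg i)),
    forall S : (forall n, X n -> Prop),
      is_subcomplex S -> (forall i, S (deg i) (g i)) -> forall n x, S n x.

(* The kernel condition is required of every epimorphism from a finitely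
   generated complex, which need not be projective. *)
Definition finitely_presented X : Prop :=
  finitely_generated X /\
  forall (L : complex R) (p : chain_map L X),
    finitely_generated L -> epi p -> finitely_generated (ker_complex p).

Definition FP_injective A : Prop :=
  forall F, finitely_presented F -> Ext1_zero F A.

Definition injective_complex I : Prop :=
  forall (X Y : complex R) (i : chain_map X Y) (f : chain_map X I),
    mono i -> exists g : chain_map Y I, forall n x, g n (i n x) = f n x.
End Complexes.

(* Chain complexes in the abelian category Ch(R); exactness is degreewise. *)
Record dcomplex (R : pzRingType) : Type := DComplex {
  dobj :> int -> complex R;
  ddiff : forall n : int, chain_map (dobj n) (dobj (n - 1));
  ddiffK : forall (n m : int) (x : dobj n m),
    ddiff (n - 1) m (ddiff n m x) = 0
}.

Section Ding.
Context {R : pzRingType}.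
Implicit Types (E : dcomplex R) (A G : complex R).

Definition dexact E : Prop :=
  forall n, exact_at (ddiff E n) (ddiff E (n - 1)).

(* Exactness of the complex of abelian groups Hom(A, E_n), n in Z. *)
Definition Hom_exact A E : Prop :=
  forall n (f : chain_map A (E (n - 1))),
    (forall m a, ddiff E (n - 1) m (f m a) = 0) ->
    exists g : chain_map A (E n), forall m a, ddiff E n m (g m a) = f m a.

Definition cycles E (n : int) : complex R := ker_complex (ddiff E n).

(* G is Z_0 E up to isomorphism of complexes. *)
Definition weakly_Ding_injective G : Prop :=
  exists E,
    [/\ dexact E, (forall n, FP_injective (E n)),
        (forall A, FP_injective A -> Hom_exact A E) &
        cplx_iso G (cycles E 0)].

Definition Ding_injective G : Prop :=
  exists E,
    [/\ dexact E, (forall n, injective_complex (E n)),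
        (forall A, FP_injective A -> Hom_exact A E) &
        cplx_iso G (cycles E 0)].
End Ding.

(* Main.v *)
Require Import Defs.
From HB Require Import structures.
From mathcomp Require Import all_boot all_order all_algebra.
From mathcomp Require Import boolp classical_sets functions.
Set Implicit Arguments.
Unset Strict Implicit.
Unset Printing Implicit Defensive.

(* Write F for the class of FP-injective complexes, call an epimorphism proper
   (FP_precover) when every map from a member of F lifts along it, and compare maps modulo
   those factoring through injectives.  The cycles of the given complex form a
   family in which every W has proper sequences 0 -> K -> C -> W -> 0 and
   0 -> W -> D -> H -> 0 with C, D in F and K, H in the family.

   For G in the family, pushing C -> G out along C -> I with I injective yields
   h : G -> G factoring through D such that e = 1 - h kills, modulo injectives,
   every map from F to G.  So e is idempotent modulo injectives, and an
   Eilenberg swindle on countable powers splits it: G + I' = L + B with I'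
   injective, B in F, and every map from F to L factoring through an injective.
   Injective complexes have the exchange property, whence G = L1 + B1 with L1 a
   summand of L and B1 a summand of B.

   The properness of the two steps to the right of G turns the factorization
   property of L1 into Ext^1(F, L1) = 0.  The complexes X with Ext^1(F, X) = 0
   that are summands, up to F, of a member of the family have proper injective
   resolutions in both directions within the same class, so L1 is Ding
   injective.  Coherence enters only through the fact that F is closed under
   cokernels of monomorphisms. *)

Import Order.TTheory GRing.Theory Num.Theory.
Local Open Scope ring_scope.

(** * Submodules and quotient modules *)

(** The obstacle is that [e] is idempotent only modulo injectives, so its image in the category of
    complexes says nothing. On G^N, keeping the [h]-part of every entry and shifting the [e]-parts
    down by one loses, modulo injectives, exactly the [e]-part of entry 0. Adding a power of an
    injective turns this endomorphism into a split epimorphism of complexes, whose kernel is L.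
    Powers are used instead of coproducts because products of injectives are injective, while
    infinite coproducts need not be. The splitting thus exists only after an injective has been
    added to G, and the exchange property is what removes it again.

    The second device is the cokernel X of a monomorphism between FP-injective complexes. By
    coherence X is FP-injective, so maps from X to the end of a proper sequence lift. The explicit
    factorizations through injectives all come from such lifts. *)

Definition mklin (R : pzRingType) (U V : lmodType R) (F : U -> V)
    (lin : linear F) : {linear U -> V} :=
  HB.pack F (GRing.isLinear.Build R U V _ F lin).

Record is_submodule (R : pzRingType) (U : lmodType R) (S : U -> Prop) : Prop :=
  IsSubmodule {
    smod0 : S 0;
    smodD : forall x y, S x -> S y -> S (x + y);
    smodZ : forall a x, S x -> S (a *: x) }.

Section Submodule.
Context {R : pzRingType} {U : lmodType R} {S : U -> Prop}.

Definition submod_pred (HS : is_submodule S) : {pred U} := [pred x | `[<S x>]].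

(** [choose] depends only on the extension of its predicate, not on the default value satisfying it,
    so a whole coset shares one representative. The quotient is the subtype of these
    representatives. *)
Definition quot_rep (HS : is_submodule S) (x : U) : U :=
  choose (fun y => `[<S (y - x)>]) x.

Context (HS : is_submodule S).

Lemma submod_pred_closed : GRing.submod_closed (submod_pred HS).
Proof.
split=> [|a x y]; rewrite !inE; first exact: (smod0 HS).
by move=> Sx Sy; apply: (smodD HS) => //; apply: (smodZ HS).
Qed.
HB.instance Definition _ :=
  GRing.isSubmodClosed.Build R U (submod_pred HS) submod_pred_closed.

Record submodule : Type :=
  Submodule { smval :> U; smvalP : smval \in submod_pred HS }.
HB.instance Definition _ := [isSub for smval].
HB.instance Definition _ := [Choice of submodule by <:].
HB.instance Definition _ := [SubChoice_isSubLmodule of submodule by <:].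

Lemma smodN x : S x -> S (- x).
Proof. by move=> Sx; rewrite -scaleN1r; apply: (smodZ HS). Qed.
Lemma smodB x y : S x -> S y -> S (x - y).
Proof. by move=> Sx Sy; apply: (smodD HS) => //; apply: smodN. Qed.


Lemma quot_repP x : S (quot_rep HS x - x).
Proof.
apply/asboolP; apply: (@chooseP _ (fun y => `[<S (y - x)>])).
by apply/asboolP; rewrite subrr; apply: smod0.
Qed.

Lemma quot_rep_eq x y : S (x - y) -> quot_rep HS x = quot_rep HS y.
Proof.
move=> Sxy; have e : (fun z => `[<S (z - x)>]) =1 (fun z => `[<S (z - y)>]).
  move=> z; apply/asboolP/asboolP => Sz.
    by rewrite -(subrK x z) -addrA; apply: (smodD HS).
  by rewrite -(subrK y z) -addrA; apply: (smodD HS) => //; rewrite -opprB; apply: smodN.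
rewrite /quot_rep (eq_choose e); apply: choose_id; apply/asboolP=> //.
by rewrite subrr; apply: smod0.
Qed.

Record quotient : Type := Quotient { qval : U; qvalP : quot_rep HS qval == qval }.
HB.instance Definition _ := [isSub for qval].
HB.instance Definition _ := [Choice of quotient by <:].

Lemma quot_rep_id x : quot_rep HS (quot_rep HS x) == quot_rep HS x.
Proof. by apply/eqP/quot_rep_eq/quot_repP. Qed.

Definition qclass (x : U) : quotient := Quotient (quot_rep_id x).

Lemma qclassK a : qclass (qval a) = a.
Proof. by apply: val_inj; apply/eqP/qvalP. Qed.

Lemma qclass_eqP x y : qclass x = qclass y <-> S (x - y).
Proof.
split=> [/(congr1 qval) /= e|Sxy]; last by apply: val_inj; apply: quot_rep_eq.
have := smodB (quot_repP y) (quot_repP x).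
by rewrite e opprB [_ + (x - _)]addrC addrA subrK.
Qed.

Definition qadd a b := qclass (qval a + qval b).
Definition qopp a := qclass (- qval a).
Definition qscale c a := qclass (c *: qval a).

Lemma qaddE x y : qadd (qclass x) (qclass y) = qclass (x + y).
Proof.
by apply/qclass_eqP; rewrite opprD addrACA; apply: (smodD HS); apply: quot_repP.
Qed.
Lemma qoppE x : qopp (qclass x) = qclass (- x).
Proof. by apply/qclass_eqP; rewrite -opprD; apply/smodN/quot_repP. Qed.
Lemma qscaleE c x : qscale c (qclass x) = qclass (c *: x).
Proof. by apply/qclass_eqP; rewrite -scalerBr; apply/(smodZ HS)/quot_repP. Qed.

Lemma qaddA : associative qadd.
Proof.
by move=> a b c; rewrite -[a]qclassK -[b]qclassK -[c]qclassK !qaddE addrA.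
Qed.
Lemma qaddC : commutative qadd.
Proof. by move=> a b; rewrite /qadd addrC. Qed.
Lemma qadd0 : left_id (qclass 0) qadd.
Proof. by move=> a; rewrite -[a]qclassK qaddE add0r. Qed.
Lemma qaddN : left_inverse (qclass 0) qopp qadd.
Proof. by move=> a; rewrite -[a]qclassK qoppE qaddE addNr. Qed.
HB.instance Definition _ := GRing.isZmodule.Build quotient qaddA qaddC qadd0 qaddN.

Lemma qscaleA a b u : qscale a (qscale b u) = qscale (a * b) u.
Proof. by rewrite -[u]qclassK !qscaleE scalerA. Qed.
Lemma qscale1 : left_id 1 qscale.
Proof. by move=> u; rewrite -[u]qclassK qscaleE scale1r. Qed.
Lemma qscaleDr : right_distributive qscale +%R.
Proof.
move=> a u v; rewrite -[u]qclassK -[v]qclassK.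
by rewrite /GRing.add /= qaddE !qscaleE qaddE scalerDr.
Qed.
Lemma qscaleDl u : {morph qscale^~ u : a b / a + b}.
Proof.
by move=> a b; rewrite -[u]qclassK {2}/GRing.add /= !qscaleE qaddE scalerDl.
Qed.
HB.instance Definition _ :=
  GRing.Zmodule_isLmodule.Build R quotient qscaleA qscale1 qscaleDr qscaleDl.

Lemma qclass_linear : linear qclass.
Proof.
by move=> a x y; rewrite /GRing.add /GRing.scale /= qscaleE qaddE.
Qed.
HB.instance Definition _ := GRing.isLinear.Build R _ _ _ qclass qclass_linear.

End Submodule.

(** * Chain maps *)

Section Combinators.
Context {R : pzRingType}.
Implicit Types X Y Z W : complex R.

Definition mkmap X Y (F : forall n, X n -> Y n) (lin : forall n, linear (F n))
    (comm : forall n x, F (n - 1) (cdiff n x) = cdiff n (F n x)) :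
  chain_map X Y := @ChainMap R X Y (fun n => mklin (lin n)) comm.

Definition cident X : chain_map X X.
Proof. by apply: (@mkmap X X (fun _ x => x)). Defined.

Definition ccomp X Y Z (g : chain_map Y Z) (f : chain_map X Y) : chain_map X Z.
Proof.
apply: (@mkmap X Z (fun n x => g n (f n x))) => [n a x y|n x].
  by rewrite !linearP.
by rewrite !cmapP.
Defined.

Definition cadd X Y (f g : chain_map X Y) : chain_map X Y.
Proof.
apply: (@mkmap X Y (fun n x => f n x + g n x)) => [n a x y|n x].
  by rewrite !linearP scalerDr addrACA.
by rewrite !cmapP linearD.
Defined.

Definition copp X Y (f : chain_map X Y) : chain_map X Y.
Proof.
apply: (@mkmap X Y (fun n x => - f n x)) => [n a x y|n x].
  by rewrite !linearP.
by rewrite !cmapP linearN.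
Defined.

Definition csub X Y (f g : chain_map X Y) : chain_map X Y := cadd f (copp g).

Definition czero X Y : chain_map X Y.
Proof.
apply: (@mkmap X Y (fun n x => 0)) => [n a x y|n x]; last by rewrite linear0.
by rewrite scaler0 addr0.
Defined.

Definition cfst X Y : chain_map (dsum X Y) X.
Proof. by apply: (@mkmap (dsum X Y) X (fun n u => u.1)). Defined.

Definition csnd X Y : chain_map (dsum X Y) Y.
Proof. by apply: (@mkmap (dsum X Y) Y (fun n u => u.2)). Defined.

Definition cpair X Y Z (f : chain_map X Y) (g : chain_map X Z) :
  chain_map X (dsum Y Z).
Proof.
apply: (@mkmap X (dsum Y Z) (fun n x => (f n x, g n x))) => [n a x y|n x].
  by rewrite !linearP.
by rewrite !cmapP.
Defined.

Definition ccopair X Y Z (f : chain_map X Z) (g : chain_map Y Z) :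
  chain_map (dsum X Y) Z := cadd (ccomp f (cfst X Y)) (ccomp g (csnd X Y)).

Definition ckval X Y (f : chain_map X Y) : chain_map (ker_complex f) X.
Proof. by apply: (@mkmap (ker_complex f) X (fun n x => kval x)). Defined.

Lemma ckvalP X Y (f : chain_map X Y) n (x : ker_complex f n) : f n (kval x) = 0.
Proof. by have /eqP := kvalP x. Qed.

Lemma ker_val_exists X Y (f : chain_map X Y) n (x : X n) :
  f n x = 0 -> exists k : ker_complex f n, kval k = x.
Proof.
move=> fx; have kx : x \in ker_pred (f n) by rewrite inE fx.
by exists (Kernel kx).
Qed.

Lemma ckval_mono X Y (f : chain_map X Y) : mono (ckval f).
Proof. by move=> n x y xy; apply: val_inj. Qed.

Lemma ckval_exact X Y (f : chain_map X Y) : exact_at (ckval f) f.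
Proof.
move=> n x; split=> [/ker_val_exists [k <-]|[k <-]]; first by exists k.
exact: ckvalP.
Qed.

Lemma pow_diff_linear X n :
  linear (fun (z : nat -> X n) k => cdiff n (z k)).
Proof. by move=> a x y; apply/funext => k; rewrite !fctE linearP. Qed.

Lemma pow_diffK X n (z : nat -> X n) :
  mklin (@pow_diff_linear X (n - 1)) (mklin (@pow_diff_linear X n) z) = 0.
Proof. by apply/funext => k; rewrite /= cdiffK. Qed.

Definition pow X : complex R :=
  @Complex R (fun n => nat -> X n : Type) (fun n => mklin (@pow_diff_linear X n))
    (@pow_diffK X).

Definition cproj X (k : nat) : chain_map (pow X) X.
Proof. by apply: (@mkmap (pow X) X (fun n (z : pow X n) => z k)). Defined.

Definition ctuple Y X (f : nat -> chain_map Y X) : chain_map Y (pow X).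
Proof.
apply: (@mkmap Y (pow X) (fun n y => (fun k => f k n y) : pow X n)) => [n a x y|n x].
  by apply/funext => k; rewrite !fctE linearP.
by apply/funext => k; rewrite cmapP.
Defined.

Lemma subcomplex_submodule X (S : forall n, X n -> Prop) :
  is_subcomplex S -> forall n, is_submodule (S n).
Proof. by case=> s0 sD sZ _ n; split=> [|x y|a x]; [apply: s0|apply: sD|apply: sZ]. Qed.

Section Subquotient.
Context {X : complex R} {S : forall n, X n -> Prop} (HS : is_subcomplex S).
Let H := subcomplex_submodule HS.

Lemma subcplx_diffP n (x : submodule (H n)) :
  cdiff n (smval x) \in submod_pred (H (n - 1)).
Proof. by have /asboolP Sx := smvalP x; apply/asboolP; exact: (sub_diff HS). Qed.

Lemma subcplx_diff_linear n :
  linear (fun x : submodule (H n) => Submodule (subcplx_diffP x)).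
Proof. by move=> a x y; apply: val_inj; rewrite /= linearP. Qed.

Lemma subcplx_diffK n (x : submodule (H n)) :
  mklin (@subcplx_diff_linear (n - 1)) (mklin (@subcplx_diff_linear n) x) = 0.
Proof. by apply: val_inj; rewrite /= cdiffK. Qed.

Definition subcplx : complex R :=
  @Complex R (fun n => submodule (H n)) (fun n => mklin (@subcplx_diff_linear n))
    (@subcplx_diffK).

Let quot_diff n (x : quotient (H n)) : quotient (H (n - 1)) :=
  qclass (H (n - 1)) (cdiff n (qval x)).

Lemma quot_diffE n x : quot_diff (qclass (H n) x) = qclass (H (n - 1)) (cdiff n x).
Proof.
apply/qclass_eqP; rewrite -linearB; apply: (sub_diff HS) => //.
exact: quot_repP.
Qed.

Lemma quot_diff_linear n : linear (@quot_diff n).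
Proof.
move=> a x y; rewrite -[x]qclassK -[y]qclassK -linearP !quot_diffE.
by rewrite !linearP.
Qed.

Lemma quot_diffK n (x : quotient (H n)) :
  mklin (@quot_diff_linear (n - 1)) (mklin (@quot_diff_linear n) x) = 0.
Proof. by rewrite -[x]qclassK /= !quot_diffE cdiffK linear0. Qed.

Definition quotcplx : complex R :=
  @Complex R (fun n => quotient (H n)) (fun n => mklin (@quot_diff_linear n))
    (@quot_diffK).
End Subquotient.

Definition csub_incl X S (HS : @is_subcomplex R X S) : chain_map (subcplx HS) X.
Proof. by apply: (@mkmap (subcplx HS) X (fun n x => smval x)). Defined.

Lemma csub_incl_mono X S (HS : @is_subcomplex R X S) : mono (csub_incl HS).
Proof. by move=> n x y xy; apply: val_inj. Qed.

Lemma csub_inclP X S (HS : @is_subcomplex R X S) n (x : subcplx HS n) :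
  S n (csub_incl HS n x).
Proof. by have /asboolP := smvalP x. Qed.

Lemma csub_incl_exists X S (HS : @is_subcomplex R X S) n (x : X n) :
  S n x -> exists y, csub_incl HS n y = x.
Proof.
move=> Sx; have kx : x \in submod_pred (subcomplex_submodule HS n) by apply/asboolP.
by exists (Submodule kx).
Qed.

Definition cquot_proj X S (HS : @is_subcomplex R X S) : chain_map X (quotcplx HS).
Proof.
apply: (@mkmap X (quotcplx HS)
         (fun n x => qclass (subcomplex_submodule HS n) x)) => [n a x y|n x].
  by rewrite linearP.
apply/qclass_eqP; rewrite -linearB; apply: sub_diff => //=.
rewrite -opprB; apply: (smodN (subcomplex_submodule HS n)); exact: quot_repP.
Defined.

Lemma cquot_proj_epi X S (HS : @is_subcomplex R X S) : epi (cquot_proj HS).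
Proof. by move=> n y; exists (qval y); apply: qclassK. Qed.

Lemma cquot_proj_ker X S (HS : @is_subcomplex R X S) n (x : X n) :
  cquot_proj HS n x = 0 <-> S n x.
Proof.
rewrite -[X in _ <-> S n X]subr0 -(qclass_eqP (subcomplex_submodule HS n)).
by rewrite linear0.
Qed.

(** Unique choice: by linearity, a relation that is single-valued at 0 is single-valued everywhere.
    This gives factorizations through epimorphisms and monomorphisms without choosing sections. *)
Lemma chain_map_of_rel X Y (Q : forall n, X n -> Y n -> Prop) :
  (forall n x, exists y, Q n x y) ->
  (forall n y, Q n 0 y -> y = 0) ->
  (forall n a x x' y y', Q n x y -> Q n x' y' -> Q n (a *: x + x') (a *: y + y')) ->
  (forall n x y, Q n x y -> Q (n - 1) (cdiff n x) (cdiff n y)) ->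
  exists f : chain_map X Y, forall n x, Q n x (f n x).
Proof.
move=> tot fun0 lin dif.
have uniq n x y y' : Q n x y -> Q n x y' -> y = y'.
  move=> Qy Qy'; apply/eqP; rewrite -subr_eq0; apply/eqP/(fun0 n).
  have := lin n (-1) x x y' y Qy' Qy.
  by rewrite !scaleN1r addNr addrC.
pose F n x := projT1 (cid (tot n x)).
have FP n x : Q n x (F n x) by exact: projT2 (cid (tot n x)).
have Flin n : linear (F n).
  by move=> a x y; apply: (uniq n (a *: x + y)) => //; apply: lin.
have Fd n x : F (n - 1) (cdiff n x) = cdiff n (F n x).
  by apply: (uniq _ (cdiff n x)) => //; apply: dif.
by exists (mkmap Flin Fd).
Qed.

Lemma factor_epi X Y Z (p : chain_map X Y) (t : chain_map X Z) :
  epi p -> (forall n x, p n x = 0 -> t n x = 0) ->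
  exists s : chain_map Y Z, forall n x, s n (p n x) = t n x.
Proof.
move=> pe pt.
have [n y|n z [x px <-]|n a y y' z z'|n y z|s sP] :=
    @chain_map_of_rel Y Z (fun n y z => exists2 x, p n x = y & t n x = z).
- by have [x px] := pe n y; exists (t n x), x.
- exact: pt.
- by move=> [x <- <-] [x' <- <-]; exists (a *: x + x'); rewrite linearP.
- by move=> [x <- <-]; exists (cdiff n x); rewrite cmapP.
exists s => n x; have [x' px' <-] := sP n (p n x).
apply/eqP; rewrite -subr_eq0 -linearB; apply/eqP/pt.
by rewrite linearB px' subrr.
Qed.

Lemma lift_mono A M X (i : chain_map A M) (t : chain_map X M) :
  mono i -> (forall n x, exists a, i n a = t n x) ->
  exists s : chain_map X A, forall n x, i n (s n x) = t n x.
Proof.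
move=> im it.
have [n x|n y|n a x x' y y'|n x y|s sP] :=
    @chain_map_of_rel X A (fun n x a => i n a = t n x).
- exact: it.
- by rewrite linear0 -[in RHS](linear0 (i n)) => /im.
- by rewrite !linearP => -> ->.
- by rewrite !cmapP => ->.
by exists s.
Qed.

Definition ses X Y Z (i : chain_map X Y) (p : chain_map Y Z) : Prop :=
  [/\ mono i, epi p & exact_at i p].

Lemma ses0 X Y Z (i : chain_map X Y) (p : chain_map Y Z) :
  exact_at i p -> forall n x, p n (i n x) = 0.
Proof. by move=> ex n x; apply/ex; exists x. Qed.

Lemma monoP X Y (i : chain_map X Y) :
  (forall n x, i n x = 0 -> x = 0) -> mono i.
Proof.
move=> i0 n x y e; apply/eqP; rewrite -subr_eq0; apply/eqP/(i0 n).
by rewrite linearB e subrr.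
Qed.

Lemma mono0 X Y (i : chain_map X Y) : mono i ->
  forall n x, i n x = 0 -> x = 0.
Proof. by move=> im n x ix; apply: (im n); rewrite ix linear0. Qed.

Lemma image_subcomplex X Y (f : chain_map X Y) :
  is_subcomplex (fun n y => exists x, f n x = y).
Proof.
split=> [n|n _ _ [x <-] [y <-]|n a _ [x <-]|n _ [x <-]].
- by exists 0; rewrite linear0.
- by exists (x + y); rewrite linearD.
- by exists (a *: x); rewrite linearZ.
- by exists (cdiff n x); rewrite cmapP.
Qed.

Lemma cokernel_exists X Y (f : chain_map X Y) :
  exists (C : complex R) (p : chain_map Y C), epi p /\ exact_at f p.
Proof.
exists _, (cquot_proj (image_subcomplex f)); split; first exact: cquot_proj_epi.
by move=> n y; apply: cquot_proj_ker.
Qed.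

Lemma kernel_exists X Y (p : chain_map X Y) :
  exists (K : complex R) (k : chain_map K X), mono k /\ exact_at k p.
Proof. by exists _, (ckval p); split; [apply: ckval_mono | apply: ckval_exact]. Qed.

Lemma lift_ker X Y Z W (k : chain_map X Y) (p : chain_map Y Z) (t : chain_map W Y) :
  mono k -> exact_at k p -> (forall n x, p n (t n x) = 0) ->
  exists s : chain_map W X, forall n x, k n (s n x) = t n x.
Proof. by move=> km ex pt; apply: lift_mono => // n x; apply/ex. Qed.

Lemma factor_coker X Y Z W (k : chain_map X Y) (p : chain_map Y Z)
    (t : chain_map Y W) :
  epi p -> exact_at k p -> (forall n x, t n (k n x) = 0) ->
  exists s : chain_map Z W, forall n x, s n (p n x) = t n x.
Proof.
by move=> pe ex tk; apply: factor_epi => // n x /ex [x' <-].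
Qed.

End Combinators.
Arguments cproj {R} X k.

(** * Enough injectives *)

(** [Zorn_bigcup] also tests the empty chain, so it is run with the empty set adjoined to [P]. If
    the empty set comes out maximal, no member of [P] has an element. *)
Lemma Zorn_nonempty (T : Type) (P : set (set T)) :
  (exists A, P A) ->
  (forall F : set (set T), (F `<=` P)%classic -> (exists A, F A) ->
     total_on F subset -> P (\bigcup_(X in F) X)%classic) ->
  exists A, P A /\ forall B, (A `<=` B)%classic -> P B -> (B `<=` A)%classic.
Proof.
move=> [A0 PA0] chain.
have [F FP totF|A [[PA|A_0] Amax]] :=
    @Zorn_bigcup T (fun A => P A \/ A = set0).
- have [[A FA PA]|noP] := pselect (exists2 A, F A & P A); last first.
    right; apply/seteqP; split=> // x [A FA Ax].
    by case: (FP A FA) => [PA|A0']; [case: noP; exists A | rewrite A0' in Ax].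
  left; have -> : (\bigcup_(X in F) X = \bigcup_(X in F `&` P) X)%classic.
    apply/seteqP; split=> x [B]; last by move=> [FB _] Bx; exists B.
    move=> FB Bx; exists B => //; split=> //.
    by case: (FP B FB) => // B0; rewrite B0 in Bx.
  apply: chain => [B []//||B C [FB _] [FC _]]; first by exists A.
  exact: totF.
- exists A; split=> // B AB PB; apply: contrapT => nBA.
  by apply: (Amax B); [split|left].
- exists A0; split=> // B A0B PB x Bx; exfalso; apply: (Amax B); last by left.
  by rewrite A_0; split=> // B0; have := B0 x Bx.
Qed.

Lemma int_ideal (P : int -> Prop) :
  P 0 -> (forall a b, P a -> P b -> P (a - b)) ->
  exists m : nat, P m%:Z /\ forall n, P n -> (m%:Z %| n)%Z.
Proof.
move=> P0 PB.
have PN a : P a -> P (- a) by move=> Pa; rewrite -sub0r; apply: PB.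
have PM (a : int) (k : int) : P a -> P (a *~ k).
  move=> Pa; have Pn (j : nat) : P (a *~ j).
    elim: j => [|j IH]; first by rewrite mulr0z.
    by rewrite -addn1 PoszD mulrzDr mulr1z -[X in P (_ + X)]opprK; apply/PB/PN.
  by case: k => k; [apply: Pn | rewrite NegzE mulrNz; apply/PN/Pn].
have [ex|none] := pselect (exists m : nat, (0 < m)%N && `[<P m%:Z>]).
  case: (ex_minnP ex) => m /andP[m0 /asboolP Pm] mmin; exists m; split=> // n Pn.
  have Pmod : P (n %% m)%Z.
    by rewrite /modz mulrC -mulrzz; apply: PB => //; apply: PM.
  have := modz_ge0 n (d := m); rewrite eqz_nat -lt0n m0 => /(_ isT).
  case E : (n %% m)%Z Pmod => [r|//] Pr _.
  case: (posnP r) => [r0|r0].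
    by apply/dvdz_mod0P; rewrite E r0.
  have := mmin r; rewrite r0 (asboolT Pr) => /(_ isT) mr.
  have := ltz_pmod n (d := m); rewrite ltz_nat m0 E ltz_nat => /(_ isT).
  by rewrite ltnNge mr.
exists 0%N; split=> // n Pn; rewrite dvd0z; apply/eqP.
case: n Pn => [[//|n]|n] Pn; case: none; exists n.+1; rewrite /= asboolT //.
by rewrite NegzE in Pn; rewrite -[_%:Z]opprK; apply: PN.
Qed.

(** * Divisible groups and characters *)

Definition divisible (D : zmodType) : Prop :=
  forall (d : D) (m : nat), (0 < m)%N -> exists d', d' *+ m = d.

Lemma subr_swap (V : zmodType) (a b c d : V) : a - b - (c - d) = a - c - (b - d).
Proof. by rewrite !opprB [LHS]addrACA [RHS]addrACA [- b - c]addrC. Qed.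

(** Baer's argument for abelian groups. Partial homomorphisms are represented by their graphs, so
    that the union of a chain is a plain union of sets. *)
Lemma extend_graph (Y D : zmodType) (G0 : set (Y * D)) :
  divisible D -> G0 0 -> (forall p q, G0 p -> G0 q -> G0 (p - q)) ->
  (forall d, G0 (0, d) -> d = 0) ->
  exists g : Y -> D, {morph g : x y / x - y} /\ forall p, G0 p -> g p.1 = p.2.
Proof.
move=> divD G00 G0B G0f.
pose good (G : set (Y * D)) := [/\ (G0 `<=` G)%classic,
  (forall p q, G p -> G q -> G (p - q)) & (forall d, G (0, d) -> d = 0)].
have [|F Fgood [A FA] totF|G [[G0G GB Gf] Gmax]] := @Zorn_nonempty _ good.
- by exists G0; split.
- split=> [p G0p|p q [B FB Bp] [C FC Cq]|d [B FB Bd]].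
  + by exists A => //; case: (Fgood A FA) => + _ _; apply.
  + have [BC|CB] := totF B C FB FC.
      by exists C => //; case: (Fgood C FC) => _ + _; apply=> //; apply: BC.
    by exists B => //; case: (Fgood B FB) => _ + _; apply=> //; apply: CB.
  + by case: (Fgood B FB) => _ _; apply.
have GN p : G p -> G (- p) by move=> Gp; rewrite -sub0r; apply: GB => //; apply: G0G.
have GD p q : G p -> G q -> G (p + q).
  by move=> Gp Gq; rewrite -[q]opprK; apply/GB/GN.
have GM p (k : int) : G p -> G (p *~ k).
  move=> Gp; have Gn (j : nat) : G (p *~ j).
    elim: j => [|j IH]; first by rewrite mulr0z; apply: G0G.
    by rewrite -addn1 PoszD mulrzDr mulr1z; apply: GD.
  by case: k => k; [apply: Gn | rewrite NegzE mulrNz; apply/GN/Gn].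
have pairMz (u : Y) (d : D) (k : int) : (u, d) *~ k = (u *~ k, d *~ k).
  have pn (j : nat) : (u, d) *+ j = (u *+ j, d *+ j).
    by elim: j => [|j IH]; rewrite ?mulr0n // !mulrS IH.
  by case: k => k; rewrite ?NegzE ?mulrNz -?pmulrn pn.
have tot y : exists d, G (y, d).
  (* [m] generates the ideal of the integers n for which n y lies in the domain of the maximal
     graph. *)
  have [m [[d0 Gd0] mP]] : exists m : nat, (exists d, G (y *~ m, d)) /\
      forall n, (exists d, G (y *~ n, d)) -> (m%:Z %| n)%Z.
    apply: (@int_ideal (fun n => exists d, G (y *~ n, d))).
      by exists 0; rewrite mulr0z; apply: G0G.
    by move=> a b [d Gd] [e Ge]; exists (d - e); rewrite mulrzBr; apply: (GB _ _ Gd Ge).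
  (* [d1] is to be the value at [y]. For m = 0 no nonzero multiple of [y] is in the domain, and the
     value 0 is taken. *)
  have [d1 d1E] : exists d1, d1 *~ m = d0.
    case: (posnP m) => [m0|/(divD d0) [d' <-]]; last by exists d'.
    by exists 0; rewrite mul0rz; apply/esym/Gf; rewrite m0 mulr0z in Gd0.
  pose G' : set (Y * D) := fun p => exists n, G (p.1 - y *~ n, p.2 - d1 *~ n).
  have GG' : (G `<=` G')%classic.
    by move=> [u d] Gp; exists 0; rewrite /= !mulr0z !subr0.
  have sub : (G' `<=` G)%classic.
    apply: Gmax => //; split.
    - by move=> p /G0G; apply: GG'.
    - move=> [u d] [v e] [a Ga] [b Gb]; exists (a - b).
      rewrite /= !mulrzBr; have := GB _ _ Ga Gb; congr (G _).
      by congr pair; apply: subr_swap.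
    - move=> d [n]; rewrite /= sub0r -mulrNz => Gn.
      have /dvdzP [k nE] : (m%:Z %| - n)%Z by apply: mP; exists (d - d1 *~ n).
      have := GB _ _ Gn (GM _ k Gd0); rewrite pairMz -mulrzA mulrC -nE.
      set z := (_ - _); have -> : z = (0, d).
        rewrite /z; congr pair; first by rewrite /= subrr.
        by rewrite /= -d1E -mulrzA mulrC -nE mulrNz opprK subrK.
      exact: Gf.
  exists d1; apply: sub; exists 1; rewrite /= !mulr1z !subrr; exact: G0G.
exists (fun y => projT1 (cid (tot y))).
have gP y : G (y, projT1 (cid (tot y))) by exact: projT2 (cid (tot y)).
have uniq y d d' : G (y, d) -> G (y, d') -> d = d'.
  move=> Gd Gd'; apply/eqP; rewrite -subr_eq0; apply/eqP/Gf.
  by have := GB _ _ Gd Gd'; congr (G _); congr pair; rewrite /= subrr.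
split=> [x y|[x d] /G0G Gp]; last exact: uniq (gP x) Gp.
by apply: uniq (gP _) _; have := GB _ _ (gP x) (gP y).
Qed.

Lemma rat_int_submodule :
  is_submodule (fun q : zmodule rat => exists n : int, q = n%:~R :> rat).
Proof.
split=> [|x y [a ->] [b ->]|k x [a ->]]; first by exists 0.
- by exists (a + b); rewrite -rmorphD.
- by exists (k * a); rewrite rmorphM /= mulrzl.
Qed.

Definition QmodZ := quotient rat_int_submodule.
HB.instance Definition _ := GRing.Zmodule.on QmodZ.

Lemma QmodZ_divisible : divisible QmodZ.
Proof.
move=> d m m0; exists (qclass rat_int_submodule ((qval d : rat) / m%:R)).
rewrite -raddfMn -[RHS]qclassK; congr (qclass _ _).
rewrite -[LHS]mulr_natr; apply: mulfVK.
by rewrite pnatr_eq0 -lt0n.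
Qed.

Lemma QmodZ_cogenerator (M : zmodType) (x : M) : x != 0 ->
  exists f : M -> QmodZ, {morph f : x y / x - y} /\ f x != 0.
Proof.
move=> x0.
have [m [m0 mP]] : exists m : nat, x *~ m = 0 /\
    forall n : int, x *~ n = 0 -> (m%:Z %| n)%Z.
  apply: (@int_ideal (fun n => x *~ n = 0)); first by rewrite mulr0z.
  by move=> a b xa xb; rewrite mulrzBr xa xb subrr.
(* An element of order m goes to the class of 1/m, and one of infinite order (m = 0) to any nonzero
   class, here that of 1/2. *)
pose c : zmodule rat := if m is 0%N then 2%:R^-1 : rat else m%:R^-1.
pose cl := qclass rat_int_submodule.
have cm n : (m%:Z %| n)%Z -> cl (c *~ n) = 0.
  rewrite -[RHS](linear0 cl) => mn; apply/qclass_eqP; rewrite subr0 /c.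
  case: (m) mn => [|k] /dvdzP [j ->]; first by exists 0; rewrite mulr0 mulr0z.
  exists j; have e : ((k.+1%:R^-1 : rat) *~ k.+1%:Z) = 1.
    by rewrite -mulrzr mulVf // pnatr_eq0.
  by change ((k.+1%:R^-1 : rat) *~ (j * k.+1%:Z) = j%:~R); rewrite mulrC mulrzA e.
have c1 : cl c != 0.
  have nint (k : nat) : (1 < k)%N -> ~ exists n : int, (k%:R^-1 : rat) = n%:~R.
    move=> k1 [n nE].
    have : (n * k%:Z)%:~R = 1 :> rat.
      by rewrite rmorphM /= -nE mulVf // pnatr_eq0; case: (k) k1.
    rewrite -[1]/(1%:~R) => /intr_inj /(congr1 absz); rewrite abszM.
    move/eqP; rewrite muln_eq1 => /andP[_ /eqP kE].
    by rewrite [`|k%:Z|%N]/= in kE; rewrite kE in k1.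
  apply/eqP; rewrite -(linear0 cl) => /qclass_eqP; rewrite subr0 /c.
  case: (m) m0 => [|[|k]] m0; [exact: nint| |exact: nint].
  by rewrite mulr1z in m0; rewrite m0 eqxx in x0.
pose G0 : set (M * QmodZ) := fun p => exists n : int, p = (x *~ n, cl (c *~ n)).
have [||d [n [/esym xn ->]]|g [gB gP]] := @extend_graph M _ G0 QmodZ_divisible.
- by exists 0; congr pair; rewrite mulr0z // (linear0 cl).
- move=> _ _ [a ->] [b ->]; exists (a - b).
  congr pair; first by rewrite /= mulrzBr.
  by rewrite /= -(linearB cl) mulrzBr.
- by apply/cm/mP.
exists g; split=> //.
by have -> : g x = cl c by apply: (gP (x, cl c)); exists 1; rewrite !mulr1z.
Qed.

Lemma morphB_D (U V : zmodType) (f : U -> V) :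
  {morph f : x y / x - y} -> {morph f : x y / x + y}.
Proof.
move=> fB x y; have f0 : f 0 = 0 by have := fB 0 0; rewrite !subrr.
by rewrite -[y in LHS]opprK fB -[- y]sub0r fB f0 sub0r opprK.
Qed.

(** * Coinduced modules and injective hulls in the weak sense of embeddings *)

Section CoinducedModule.
Context {R : pzRingType} {D : zmodType}.

Definition additive_pred : {pred R -> D} :=
  [pred f | `[<{morph f : x y / x - y}>]].

Lemma additive_pred_closed : zmod_closed additive_pred.
Proof.
split=> [|f g /asboolP fB /asboolP gB]; apply/asboolP => x y.
  by rewrite /= subrr.
by rewrite [LHS]/(f (x - y) - g (x - y)) fB gB subr_swap.
Qed.
HB.instance Definition _ :=
  GRing.isZmodClosed.Build (R -> D) additive_pred additive_pred_closed.

(* Hom_Z(R, D), with the left R-action (a f)(s) = f(s a) *)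
Record coind : Type := Coind { coval :> R -> D; covalP : coval \in additive_pred }.
HB.instance Definition _ := [isSub for coval].
HB.instance Definition _ := [Choice of coind by <:].
HB.instance Definition _ := [SubChoice_isSubZmodule of coind by <:].

Lemma covalB (f : coind) : {morph coval f : x y / x - y}.
Proof. exact/asboolP/(covalP f). Qed.

Lemma coind_scaleP (a : R) (f : coind) : (fun s => f (s * a)) \in additive_pred.
Proof. by apply/asboolP => x y; rewrite mulrBl covalB. Qed.

Definition coind_scale (a : R) (f : coind) : coind := Coind (coind_scaleP a f).

Lemma coind_ext (f g : coind) : (forall s, f s = g s) -> f = g.
Proof. by move=> fg; apply/val_inj/funext. Qed.

Lemma coindDE (f g : coind) s : (f + g) s = f s + g s. Proof. by []. Qed.

Lemma coind_scaleA a b f : coind_scale a (coind_scale b f) = coind_scale (a * b) f.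
Proof. by apply: coind_ext => s; rewrite /= mulrA. Qed.
Lemma coind_scale1 : left_id 1 coind_scale.
Proof. by move=> f; apply: coind_ext => s; rewrite /= mulr1. Qed.
Lemma coind_scaleDr : right_distributive coind_scale +%R.
Proof. by move=> a f g; apply: coind_ext. Qed.
Lemma coind_scaleDl f : {morph coind_scale^~ f : a b / a + b}.
Proof.
move=> a b; apply: coind_ext => s; rewrite coindDE /= mulrDr.
exact: (morphB_D (@covalB f)).
Qed.
HB.instance Definition _ := GRing.Zmodule_isLmodule.Build R coind
  coind_scaleA coind_scale1 coind_scaleDr coind_scaleDl.

Lemma coindZE a (f : coind) s : (a *: f) s = f (s * a). Proof. by []. Qed.
End CoinducedModule.
Arguments coind : clear implicits.

Definition module_injective (R : pzRingType) (I : lmodType R) : Prop :=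
  forall (X Y : lmodType R) (i : {linear X -> Y}) (f : {linear X -> I}),
    injective i -> exists g : {linear Y -> I}, forall x, g (i x) = f x.

(** Evaluation at 1 identifies Hom_R(Y, Hom_Z(R, D)) with Hom_Z(Y, D): the additive map x |->
    f(x)(1) is extended to [g], and y |-> (s |-> g(s y)) is the linear extension. *)
Lemma coind_injective (R : pzRingType) (D : zmodType) :
  divisible D -> module_injective (coind R D).
Proof.
move=> divD X Y i f inj_i.
pose G0 : set (Y * D) := fun p => exists x, p = (i x, f x 1).
have [||d [x [/esym ix ->]]|g [gB gP]] := @extend_graph Y D G0 divD.
- by exists 0; rewrite !linear0.
- move=> _ _ [x ->] [y ->]; exists (x - y); rewrite !linearB; congr pair.
- by rewrite (inj_i x 0) ?linear0 ?ix.
have gfB y : (fun s => g (s *: y)) \in @additive_pred R D.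
  by apply/asboolP => s t; rewrite scalerBl gB.
have lin : linear (fun y => Coind (gfB y)).
  move=> a u v; apply: coind_ext => s.
  by rewrite coindDE coindZE /= scalerDr (morphB_D gB) scalerA.
exists (mklin lin) => x; apply: coind_ext => s /=.
have := gP (i (s *: x), f (s *: x) 1); rewrite /= !linearZ => ->.
  by rewrite coindZE mul1r.
by exists (s *: x); rewrite !linearZ.
Qed.

(** All characters M -> Q/Z together embed M into a power of Q/Z, which is divisible; coinducing
    that one group makes the embedding R-linear. *)
Lemma enough_injective_modules (R : pzRingType) (M : lmodType R) :
  exists (I : lmodType R) (i : {linear M -> I}), module_injective I /\ injective i.
Proof.
pose Phi := {f : M -> QmodZ | {morph f : x y / x - y}}.
have divD : divisible (Phi -> QmodZ : Type).
  move=> d m m0; have /choice [d' d'P] := fun f => QmodZ_divisible (d f) m0.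
  by exists d'; apply/funext => f; rewrite -d'P; elim: (m) => // k IH; rewrite !mulrS -IH.
have cP (x : M) : (fun (s : R) (f : Phi) => sval f (s *: x)) \in additive_pred.
  by apply/asboolP => s t; apply/funext => f; rewrite scalerBl (svalP f).
have lin : linear (fun x => Coind (cP x)).
  move=> a x y; apply: coind_ext => s; apply/funext => f.
  by rewrite coindDE coindZE /= scalerDr (morphB_D (svalP f)) scalerA.
exists _, (mklin lin); split; first exact: coind_injective.
move=> x y xy; apply/eqP; rewrite -subr_eq0; apply/negPn/negP => xy0.
have [f [fB]] := QmodZ_cogenerator xy0.
rewrite fB; have := congr1 (fun c : coind R (Phi -> QmodZ : Type) => c 1 (exist _ f fB)) xy.
by rewrite /= !scale1r => ->; rewrite subrr eqxx.
Qed.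

Section CofreeComplex.
Context {R : pzRingType} (I : int -> lmodType R).

Lemma cofree_diff_linear n :
  linear (fun u : (I n * I (n - 1))%type => (u.2, 0) : I (n - 1) * I (n - 1 - 1)).
Proof. by move=> a u v; congr pair; rewrite /= scaler0 addr0. Qed.

(* The product over n of the disks with I n in degrees n and n + 1. *)
Definition cofree_complex : complex R.
refine (@Complex R (fun n => (I n * I (n - 1))%type)
          (fun n => mklin (@cofree_diff_linear n)) _).
by [].
Defined.

(** The cofree complex is right adjoint to forgetting differentials: the first components of a chain
    map into it are arbitrary and, by [cofree_map_snd], force the second ones. Injectivity is
    therefore checked degreewise. *)
Lemma map_to_cofree (X : complex R) (f : forall n, {linear X n -> I n}) :
  exists g : chain_map X cofree_complex,
    forall n x, g n x = (f n x, f (n - 1) (cdiff n x)).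
Proof.
have lin n : linear (fun x : X n => (f n x, f (n - 1) (cdiff n x)) : cofree_complex n).
  by move=> a x y; rewrite !linearP.
have comm n x : (f (n - 1) (cdiff n x), f (n - 1 - 1) (cdiff (n - 1) (cdiff n x)))
    = @cdiff R cofree_complex n (f n x, f (n - 1) (cdiff n x)).
  by congr pair; rewrite cdiffK linear0.
by exists (@mkmap R X cofree_complex _ lin comm).
Qed.

Lemma cofree_map_snd (X : complex R) (f : chain_map X cofree_complex) n (x : X n) :
  (f n x).2 = (f (n - 1) (cdiff n x)).1.
Proof. by rewrite cmapP. Qed.

Lemma cofree_injective :
  (forall n, module_injective (I n)) -> injective_complex cofree_complex.
Proof.
move=> injI X Y i f im.
have lin n : linear (fun x => (f n x).1) by move=> a x y; rewrite linearP.
pose F n := mklin (lin n).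
pose G n := projT1 (cid (injI n _ _ (i n) (F n) (im n))).
have GP n x : G n (i n x) = (f n x).1 by exact: projT2 (cid (injI n _ _ (i n) (F n) (im n))) x.
have [g gE] := map_to_cofree G; exists g => n x.
by rewrite gE GP -cmapP GP -cofree_map_snd -surjective_pairing.
Qed.
End CofreeComplex.

Lemma enough_injectives (R : pzRingType) (X : complex R) :
  exists (I : complex R) (i : chain_map X I), injective_complex I /\ mono i.
Proof.
pose J n := projT1 (cid (enough_injective_modules (X n))).
have JP n := projT2 (cid (enough_injective_modules (X n))).
pose j n : {linear X n -> J n} := projT1 (cid (JP n)).
have [jI jm] : (forall n, module_injective (J n)) /\ (forall n, injective (j n)).
  by split=> n; have [] := projT2 (cid (JP n)).
have [g gE] := map_to_cofree j.
exists _, g; split; first exact: cofree_injective.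
by move=> n x y; rewrite !gE => -[/jm].
Qed.

(** * Finite free complexes *)

Section RowMaps.
Context {R : pzRingType}.

Lemma rowmap_linear (M : lmodType R) N (e : 'I_N -> M) :
  linear (fun v : 'rV[R]_N => \sum_j v 0 j *: e j).
Proof.
move=> a u v; rewrite scaler_sumr -big_split; apply: eq_bigr => j _.
by rewrite !mxE scalerDl scalerA.
Qed.

Definition rowmap (M : lmodType R) N (e : 'I_N -> M) : {linear 'rV[R]_N -> M} :=
  mklin (rowmap_linear e).

Lemma rowmap_delta (M : lmodType R) N (e : 'I_N -> M) j :
  rowmap e (delta_mx 0 j) = e j.
Proof.
rewrite /= (bigD1 j) //= mxE !eqxx scale1r big1 ?addr0 // => i /negPf ij.
by rewrite mxE ij andbF scale0r.
Qed.

Lemma row_lin_ext (M : lmodType R) N (f g : {linear 'rV[R]_N -> M}) :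
  (forall j, f (delta_mx 0 j) = g (delta_mx 0 j)) -> forall v, f v = g v.
Proof.
move=> fg v; rewrite (row_sum_delta v) !linear_sum; apply: eq_bigr => j _.
by rewrite !linearZ fg.
Qed.

Lemma row_lift (M N : lmodType R) k (p : {linear M -> N}) (t : {linear 'rV[R]_k -> N}) :
  (forall y, exists x, p x = y) -> exists s : {linear 'rV[R]_k -> M}, forall v, p (s v) = t v.
Proof.
move=> pe; have /choice [e eP] := fun j => pe (t (delta_mx 0 j)).
exists (rowmap e) => v.
have lin : linear (fun v => p (rowmap e v)) by move=> a x y; rewrite !linearP.
by apply: (@row_lin_ext _ _ (mklin lin) t) => j; rewrite -[RHS]eP -(rowmap_delta e j).
Qed.

(** Schanuel's argument. Coherence presents the ideal J = R^m / ker f by some p : R^k' -> J with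
    relations [q], not by the given generators [cl]. With mutual lifts [phi] and [psi] of [p] and
    [cl], ker f is generated by the values of phi q and the elements v - phi(psi v). *)
Lemma coherent_kernel1 (hR : left_coherent R) m (f : {linear 'rV[R]_m -> R^o}) :
  exists l (g : {linear 'rV[R]_l -> 'rV[R]_m}), forall v, f v = 0 <-> exists w, g w = v.
Proof.
have kerS : is_submodule (fun v => f v = 0).
  split=> [|x y fx fy|a x fx]; first exact: linear0.
    by rewrite linearD fx fy addr0.
  by rewrite linearZ_LR fx scaler0.
pose J := quotient kerS; pose cl := qclass kerS.
have clE x y : cl x = cl y <-> f x = f y.
  rewrite (qclass_eqP kerS) linearB; split=> [/eqP|->]; last by rewrite subrr.
  by rewrite subr_eq0 => /eqP.
have lin : linear (fun x : J => f (qval x)).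
  move=> a x y; rewrite -linearP; apply/clE.
  rewrite /cl qclassK; apply/esym/(etrans (qclass_linear kerS a _ _)).
  by rewrite !qclassK.
have inj : injective (mklin lin) by move=> x y /clE; rewrite /cl !qclassK.
have fg : finitely_generated_module J.
  by exists m, cl => x; exists (qval x); apply: qclassK.
have [m' [k' [q [p [pe pq]]]]] := hR _ _ inj fg.
have cle y : exists x, cl x = y by exists (qval y); apply: qclassK.
have [phi phiP] := row_lift p cle.
have [psi psiP] := row_lift cl pe.
have glin : linear (fun v : 'rV[R]_(m' + m) =>
    phi (q (lsubmx v)) + (rsubmx v - phi (psi (rsubmx v)))).
  move=> a u v; rewrite !linearP !scalerDr [RHS]addrACA; congr (_ + _).
  by rewrite [RHS]addrACA.
exists _, (mklin glin) => v; have clf x : f x = 0 <-> cl x = 0.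
  by rewrite -[X in _ <-> _ = X](linear0 cl) clE linear0.
split=> [/clf clv|[w <-]].
  have /pq [w wE] : p (psi v) = 0 by rewrite psiP.
  exists (row_mx w v); rewrite /= row_mxKl row_mxKr wE addrC subrK //.
rewrite [mklin glin w]/(_ + (_ - _)) linearD linearB.
have -> : f (phi (q (lsubmx w))) = 0.
  by apply/clf/(etrans (phiP _))/pq; exists (lsubmx w).
have -> : f (phi (psi (rsubmx w))) = f (rsubmx w) by apply/clE/(etrans (phiP _))/psiP.
by rewrite subrr addr0.
Qed.

(** Induction on the number of target coordinates: the remaining coordinates are restricted to
    generators of the kernel of the first. *)
Lemma coherent_kernel (hR : left_coherent R) k m (f : {linear 'rV[R]_m -> 'rV[R]_k}) :
  exists l (g : {linear 'rV[R]_l -> 'rV[R]_m}), forall v, f v = 0 <-> exists w, g w = v.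
Proof.
elim: k m f => [|k IH] m f.
  have lin : linear (id : 'rV[R]_m -> 'rV[R]_m) by [].
  exists m, (mklin lin) => v; split=> _; first by exists v.
  by apply/rowP => -[].
have lin1 : linear (fun v => (f v) 0 ord0 : R^o).
  by move=> a x y; rewrite linearP !mxE.
have [l [g gP]] := coherent_kernel1 hR (mklin lin1).
have lin2 : linear (fun w => \row_j (f (g w)) 0 (lift ord0 j)).
  by move=> a x y; apply/rowP => j; rewrite !linearP !mxE.
have [l' [g' g'P]] := IH _ (mklin lin2).
have lin3 : linear (fun w => g (g' w)) by move=> a x y; rewrite !linearP.
exists l', (mklin lin3) => v; split=> [fv|[w <-] /=].
  have /gP [w gw] : mklin lin1 v = 0 by rewrite /= fv mxE.
  have /g'P [w' w'E] : mklin lin2 w = 0 by apply/rowP => j; rewrite /= gw fv !mxE.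
  by exists w'; rewrite /= w'E.
apply/rowP => i; rewrite [RHS]mxE.
case: (unliftP ord0 i) => [j ->|->].
  have /rowP/(_ j) : mklin lin2 (g' w) = 0 by apply/g'P; exists w.
  by rewrite !mxE.
have : mklin lin1 (g (g' w)) = 0 by apply/gP; exists (g' w).
by [].
Qed.
End RowMaps.

(** * Free complexes on generators of prescribed degrees *)

Section Transport.
Context {R : pzRingType}.
Implicit Types X Y : complex R.

(* x, moved to degree n along m = n; the junk value 0 when m != n makes this
   additive and natural without side conditions. *)
Definition in_degree X m n (x : X m) : X n :=
  if m =P n is ReflectT e then eq_rect m (fun k => X k : Type) x n e else 0.

Lemma in_degree_id X n (x : X n) : in_degree n x = x.
Proof. by rewrite /in_degree; case: eqP => // e; rewrite eq_axiomK. Qed.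

Lemma in_degree_ne X m n (x : X m) : m != n -> in_degree n x = 0.
Proof. by rewrite /in_degree; case: eqP. Qed.

Lemma in_degree_map X Y (f : chain_map X Y) m n (x : X m) :
  f n (in_degree n x) = in_degree n (f m x).
Proof.
case: (eqVneq m n) => [mn|mn]; last by rewrite !in_degree_ne ?linear0.
by case: _ / mn; rewrite !in_degree_id.
Qed.

Lemma in_degree_diff X m n (x : X m) :
  cdiff n (in_degree n x) = in_degree (n - 1) (cdiff m x).
Proof.
case: (eqVneq m n) => [mn|mn].
  by case: _ / mn; rewrite !in_degree_id.
by rewrite !in_degree_ne ?linear0 // (inj_eq (addIr _)).
Qed.

Lemma in_degree_sub X (S : forall n, X n -> Prop) m n (x : X m) :
  is_subcomplex S -> S m x -> S n (in_degree n x).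
Proof.
move=> HS Sx; case: (eqVneq m n) => [mn|mn].
  by case: _ / mn; rewrite !in_degree_id.
by rewrite in_degree_ne //; apply: sub_zero.
Qed.

(** Uniqueness in the universal property follows from generation. The last two fields are the
    finiteness that lets coherence of R act degree by degree. *)
Record free_on (P : complex R) k (deg : 'I_k -> int) (g : forall i, P (deg i)) :
  Prop := FreeOn {
    free_gen : forall S : (forall n, P n -> Prop),
      is_subcomplex S -> (forall i, S (deg i) (g i)) -> forall n x, S n x;
    free_univ : forall X (x : forall i, X (deg i)),
      exists f : chain_map P X, forall i, f (deg i) (g i) = x i;
    free_degree : forall n, exists N (s : {linear P n -> 'rV[R]_N})
      (t : {linear 'rV[R]_N -> P n}), forall x, t (s x) = x;
    free_support : exists ns : seq int,
      forall n, n \notin ns -> forall x : P n, x = 0 }.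

Lemma sum_sub X (S : forall n, X n -> Prop) n k (F : 'I_k -> X n) :
  is_subcomplex S -> (forall i, S n (F i)) -> S n (\sum_i F i).
Proof.
move=> HS SF; apply: big_ind => //; first exact: sub_zero.
by move=> x y; apply: sub_add.
Qed.

Section FreeComplex.
Context (k : nat) (deg : 'I_k -> int).

Lemma rowpair_diff_linear :
  linear (fun u : 'rV[R]_k * 'rV[R]_k => (0, u.1) : 'rV[R]_k * 'rV[R]_k).
Proof. by move=> a u v; congr pair; rewrite /= scaler0 addr0. Qed.

(** An ambient complex with the same module in every degree: the dependence on [deg] is cut out
    afterwards as a subcomplex, so no type of generators of degree n is needed. *)
Definition rowpairs : complex R.
refine (@Complex R (fun=> ('rV[R]_k * 'rV[R]_k)%type)
          (fun=> mklin rowpair_diff_linear) _).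
by [].
Defined.

(* In degree n, the first row is supported on the generators of degree n and
   the second one on their differentials. *)
Definition free_supported n (u : rowpairs n) : Prop :=
  forall i, (deg i != n -> u.1 0 i = 0) /\ (deg i - 1 != n -> u.2 0 i = 0).

Lemma free_supported_sub : is_subcomplex free_supported.
Proof.
split=> [n i|n x y Sx Sy i|n a x Sx i|n x Sx i].
- by rewrite /= !mxE.
- have [[x1 x2] [y1 y2]] := (Sx i, Sy i).
  by split=> ne; rewrite /= !mxE ?x1 ?y1 ?x2 ?y2 ?addr0.
- by have [x1 x2] := Sx i; split=> ne; rewrite /= !mxE ?x1 ?x2 ?mulr0.
- have [x1 _] := Sx i; split=> ne; rewrite /= ?mxE //.
  by apply: x1; rewrite (inj_eq (addIr _)) in ne.
Qed.

Let P := subcplx free_supported_sub.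
Let incl : chain_map P rowpairs := csub_incl free_supported_sub.

Lemma free_gen_supported i :
  exists g : P (deg i), incl (deg i) g = (delta_mx 0 i, 0).
Proof.
apply: csub_incl_exists => j; split=> ne; rewrite !mxE //.
by case: (j =P i) ne => [->|]; rewrite ?eqxx ?andbF.
Qed.

Let g i : P (deg i) := projT1 (cid (free_gen_supported i)).
Let gE i : incl (deg i) (g i) = (delta_mx 0 i, 0).
Proof. exact: projT2 (cid (free_gen_supported i)). Qed.

(** Generator i goes to [x i] and its differential to that of [x i]. The default value of
    [in_degree] kills terms of the wrong degree, so this is a chain map on all of [rowpairs]. *)
Definition free_sum X (x : forall i, X (deg i)) n (u : rowpairs n) : X n :=
  rowmap (fun i => in_degree n (x i)) u.1 +
  rowmap (fun i => in_degree n (cdiff _ (x i))) u.2.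

Lemma free_sum_linear X (x : forall i, X (deg i)) n : linear (@free_sum X x n).
Proof.
move=> a u v; rewrite /free_sum.
rewrite [(a *: u + v).1]/(a *: u.1 + v.1) [(a *: u + v).2]/(a *: u.2 + v.2).
by rewrite !linearP scalerDr addrACA.
Qed.

Lemma rowmapE (M : lmodType R) m (e : 'I_m -> M) v :
  rowmap e v = \sum_j v 0 j *: e j.
Proof. by []. Qed.

Lemma rowmap_map (M N : lmodType R) (f : {linear M -> N}) m (e : 'I_m -> M) v :
  f (rowmap e v) = rowmap (fun i => f (e i)) v.
Proof. by rewrite /= linear_sum; apply: eq_bigr => i _; rewrite linearZ. Qed.

Lemma eq_rowmap (M : lmodType R) m (e e' : 'I_m -> M) v :
  e =1 e' -> rowmap e v = rowmap e' v.
Proof. by move=> ee; apply: eq_bigr => i _; rewrite ee. Qed.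

Lemma rowmap0 (M : lmodType R) m v : rowmap (fun _ : 'I_m => 0 : M) v = 0.
Proof. by apply: big1 => i _; rewrite scaler0. Qed.

Lemma free_sum_comm X (x : forall i, X (deg i)) n u :
  free_sum x (cdiff n u) = cdiff n (@free_sum X x n u).
Proof.
rewrite {2}/free_sum linearD !rowmap_map /free_sum linear0 add0r.
rewrite (@eq_rowmap _ _ (fun i => cdiff n (in_degree n (x i)))
  (fun i => in_degree (n - 1) (cdiff _ (x i)))) => [|i]; last exact: in_degree_diff.
rewrite (@eq_rowmap _ _ (fun i => cdiff n (in_degree n (cdiff _ (x i)))) (fun=> 0)) => [|i].
  by rewrite rowmap0 addr0.
rewrite in_degree_diff cdiffK.
by rewrite /in_degree; case: eqP => // e; case: _ / e.
Qed.

Definition free_map X (x : forall i, X (deg i)) : chain_map rowpairs X :=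
  mkmap (free_sum_linear x) (free_sum_comm x).

Lemma free_mapE X (x : forall i, X (deg i)) n u :
  free_map x n u = rowmap (fun i => in_degree n (x i)) u.1 +
    rowmap (fun i => in_degree n (cdiff _ (x i))) u.2.
Proof. by []. Qed.

Lemma free_map_nat X Y (f : chain_map X Y) (x : forall i, X (deg i)) n u :
  f n (free_map x n u) = free_map (fun i => f _ (x i)) n u.
Proof.
rewrite !free_mapE linearD !rowmap_map; congr (_ + _); apply: eq_rowmap => i.
  exact: in_degree_map.
by rewrite in_degree_map cmapP.
Qed.

Lemma free_map_gen X (x : forall i, X (deg i)) i :
  free_map x (deg i) (delta_mx 0 i, 0) = x i.
Proof.
rewrite free_mapE rowmap_delta.
by rewrite (linear0 (rowmap _)) addr0 in_degree_id.
Qed.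

Lemma in_degree_rowpairs m n (u : rowpairs m) :
  in_degree n u = if m == n then u : rowpairs n else 0.
Proof.
case: (eqVneq m n) => [mn|mn]; last exact: in_degree_ne.
by case: _ / mn; rewrite in_degree_id.
Qed.

Lemma free_map_supported n (u : rowpairs n) : free_supported u ->
  free_map (fun i => (delta_mx 0 i, 0) : rowpairs (deg i)) n u = u.
Proof.
move=> Su; rewrite free_mapE !rowmapE.
rewrite [X in X + _](eq_bigr (fun i => (u.1 0 i *: delta_mx 0 i, 0))); last first.
  move=> i _; rewrite in_degree_rowpairs; case: eqP => [_|/eqP ne].
    by congr pair; rewrite scaler0.
  by have [-> // _] := Su i; rewrite !scale0r.
rewrite [X in _ + X](eq_bigr (fun i => (0, u.2 0 i *: delta_mx 0 i))); last first.
  move=> i _; rewrite in_degree_rowpairs; case: eqP => [_|/eqP ne].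
    by congr pair; rewrite scaler0.
  by have [_ -> //] := Su i; rewrite !scale0r.
have pairsum (F G : 'I_k -> 'rV[R]_k) :
    \sum_i (F i, G i) = (\sum_i F i, \sum_i G i).
  by elim/big_rec3: _ => // i a b _ _ ->.
rewrite !pairsum -!row_sum_delta !big1 //; case: (u) => a b.
by congr pair; rewrite /= ?addr0 ?add0r.
Qed.

Lemma free_exists : exists (P : complex R) (g : forall i, P (deg i)), free_on g.
Proof.
exists P, g.
have free_mapK n (u : P n) : free_map g n (incl n u) = u.
  apply: (@csub_incl_mono _ _ _ free_supported_sub n).
  rewrite free_map_nat -[RHS](@free_map_supported n (incl n u)); last exact: csub_inclP.
  rewrite !free_mapE; congr (_ + _); apply: eq_rowmap => i; by rewrite -gE.
split.
- move=> S HS Sg n x; rewrite -[x]free_mapK; apply: (sub_add HS);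
    apply: sum_sub => // i; apply: (sub_scale HS); apply: in_degree_sub => //.
  exact: (sub_diff HS).
- move=> X x; exists (ccomp (free_map x) incl) => i.
  by rewrite -[RHS](free_map_gen x) -gE.
- move=> n; exists (k + k)%N.
  have slin : linear (fun x : P n => row_mx (incl n x).1 (incl n x).2).
    by move=> a x y; rewrite linearP scale_row_mx add_row_mx.
  have tlin : linear (fun v : 'rV[R]_(k + k) => free_map g n (lsubmx v, rsubmx v)).
    by move=> a x y; rewrite -linearP; congr (free_map g n (_, _)); rewrite linearP.
  exists (mklin slin), (mklin tlin) => x /=.
  by rewrite row_mxKl row_mxKr -surjective_pairing; apply: free_mapK.
- exists ([seq deg i | i <- enum 'I_k] ++ [seq deg i - 1 | i <- enum 'I_k]) => n.
  rewrite mem_cat negb_or => /andP[n1 n2] x; rewrite -[x]free_mapK free_mapE.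
  have ne1 i : deg i != n by apply: contraNneq n1 => <-; rewrite map_f ?mem_enum.
  have ne2 i : deg i - 1 != n by apply: contraNneq n2 => <-; apply: (map_f (fun i => deg i - 1)); rewrite mem_enum.
  rewrite (@eq_rowmap _ _ _ (fun=> 0)) => [|i]; last exact: in_degree_ne.
  rewrite rowmap0 add0r (@eq_rowmap _ _ _ (fun=> 0)) => [|i]; last exact: in_degree_ne.
  exact: rowmap0.
Qed.
End FreeComplex.
End Transport.

(** * FP-injective complexes *)

Section FreePresentations.
Context {R : pzRingType}.
Implicit Types X Y P : complex R.

Definition is_free P : Prop :=
  exists k (deg : 'I_k -> int) (g : forall i, P (deg i)), free_on g.

Lemma free_finitely_generated P : is_free P -> finitely_generated P.
Proof. by move=> [k [deg [g fr]]]; exists k, deg, g; apply: free_gen. Qed.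

Lemma equalizer_subcomplex X Y (f f' : chain_map X Y) :
  is_subcomplex (fun n x => f n x = f' n x).
Proof.
split=> [n|n x y e e'|n a x e|n x e].
- by rewrite !linear0.
- by rewrite !linearD e e'.
- by rewrite !linearZ e.
- by rewrite !cmapP e.
Qed.

Lemma free_ext P k (deg : 'I_k -> int) (g : forall i, P (deg i)) X
    (f f' : chain_map P X) :
  free_on g -> (forall i, f _ (g i) = f' _ (g i)) -> forall n x, f n x = f' n x.
Proof. by move=> fr ff' n x; apply: (free_gen fr (equalizer_subcomplex f f')). Qed.

Lemma free_lift P X Y (p : chain_map X Y) (t : chain_map P Y) :
  is_free P -> epi p -> exists s : chain_map P X, forall n x, p n (s n x) = t n x.
Proof.
move=> [k [deg [g fr]]] pe.
pose x i := projT1 (cid (pe (deg i) (t (deg i) (g i)))).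
have xP i : p _ (x i) = t _ (g i) by exact: projT2 (cid (pe (deg i) (t (deg i) (g i)))).
have [s sP] := free_univ fr x; exists s.
apply: (@free_ext _ _ _ _ _ (ccomp p s) t fr) => i.
by rewrite /= sP xP.
Qed.

Lemma fg_cover X : finitely_generated X ->
  exists P (p : chain_map P X), is_free P /\ epi p.
Proof.
move=> [k [deg [x xP]]]; have [P [g fr]] := @free_exists R _ deg.
have [p pP] := free_univ fr x; exists P, p; split; first by exists k, deg, g.
by move=> n y; apply: (xP _ (image_subcomplex p)) => i; exists (g i); apply: pP.
Qed.

Lemma epi_finitely_generated X Y (p : chain_map X Y) :
  epi p -> finitely_generated X -> finitely_generated Y.
Proof.
move=> pe [k [deg [x xP]]]; exists k, deg, (fun i => p _ (x i)) => S HS Sx n y.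
have [z <-] := pe n y; apply: (xP (fun n z => S n (p n z))) => //.
split=> [m|m u v|m a u|m u].
- by rewrite linear0; apply: sub_zero.
- by rewrite linearD; apply: sub_add.
- by rewrite linearZ; apply: sub_scale.
- by rewrite cmapP; apply: sub_diff.
Qed.

Lemma fin_gens_cover X (S : forall n, X n -> Prop) (I : finType)
    (x : I -> {n & X n}) :
  is_subcomplex S -> (forall i, S _ (projT2 (x i))) ->
  (forall T, @is_subcomplex R X T -> (forall i, T _ (projT2 (x i))) ->
     forall n y, S n y -> T n y) ->
  exists P (p : chain_map P X), is_free P /\
    forall n y, S n y <-> exists z, p n z = y.
Proof.
move=> HS Sx xP.
pose deg (i : 'I_#|I|) := projT1 (x (enum_val i)).
have [P [g fr]] := @free_exists R _ deg.
have [p pP] := free_univ fr (fun i => projT2 (x (enum_val i))).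
exists P, p; split; first by exists #|I|, deg, g.
move=> n y; split=> [|[z <-]].
  move=> Sy; apply: (xP _ (image_subcomplex p)) => // i; rewrite -[i]enum_rankK.
  by exists (g (enum_rank i)); apply: pP.
apply: (free_gen fr (S := fun n z => S n (p n z))) => [|i]; last by rewrite pP; apply: Sx.
split=> [m|m u v|m a u|m u].
- by rewrite linear0; apply: sub_zero.
- by rewrite linearD; apply: sub_add.
- by rewrite linearZ; apply: sub_scale.
- by rewrite cmapP; apply: sub_diff.
Qed.

Lemma kernel_subcomplex X Y (f : chain_map X Y) :
  is_subcomplex (fun n x => f n x = 0).
Proof.
split=> [n|n x y e e'|n a x e|n x e].
- exact: linear0.
- by rewrite linearD e e' addr0.
- by rewrite linearZ_LR e scaler0.
- by rewrite cmapP e linear0.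
Qed.

(** Only finitely many degrees of [P] are nonzero, and in each the kernel is finitely generated by
    [coherent_kernel], since the modules are retracts of row modules. The generators are collected
    by induction over the list of degrees. *)
Lemma coherent_kernel_cover (hR : left_coherent R) P Q (f : chain_map P Q) :
  is_free P -> is_free Q ->
  exists P' (f' : chain_map P' P), is_free P' /\ exact_at f' f.
Proof.
move=> [k [deg [g fr]]] [k' [deg' [g' fr']]].
have [ns nsP] := free_support fr.
suff [I [x [fx xP]]] : exists (I : finType) (x : I -> {n & P n}),
    (forall i, f _ (projT2 (x i)) = 0) /\
    forall T, @is_subcomplex R P T -> (forall i, T _ (projT2 (x i))) ->
      forall n y, n \in ns -> f n y = 0 -> T n y.
  apply: (fin_gens_cover (kernel_subcomplex f) fx) => T HT Tx n y fy.
  case: (boolP (n \in ns)) => nn; first exact: (xP T).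
  by rewrite (nsP n nn y); apply: sub_zero.
elim: ns {nsP} => [|n ns [I [x [fx xP]]]].
  by exists void, (fun i : void => match i with end); split=> [[]|].
have [N [s [t ts]]] := free_degree fr n.
have [N' [s' [t' ts']]] := free_degree fr' n.
have lin : linear (fun v => s' (f n (t v))) by move=> a u v; rewrite !linearP.
have [l [h hP]] := coherent_kernel hR (mklin lin).
pose y (j : 'I_l) : P n := t (h (delta_mx 0 j)).
exists ('I_l + I)%type, (fun i => match i with
  | inl j => existT (fun n => P n) n (y j) | inr i => x i end).
split=> [[j|i] /=|T HT Tx m z]; last 1 first.
- rewrite inE => /orP[/eqP mn|mns]; last by apply: xP => // i; apply: (Tx (inr i)).
  move: z; rewrite mn => z fz; rewrite -[z]ts.
  have /hP [w <-] : mklin lin (s z) = 0 by rewrite /= ts fz linear0.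
  rewrite (row_sum_delta w) !linear_sum; apply: sum_sub => // j.
  by rewrite !linearZ; apply: sub_scale => //; apply: (Tx (inl j)).
- rewrite -[LHS]ts' /y; have : mklin lin (h (delta_mx 0 j)) = 0.
    by apply/hP; exists (delta_mx 0 j).
  by move=> /= ->; rewrite linear0.
- exact: fx.
Qed.

(* FP-injectivity as solvability of finite systems of linear equations: a map
   out of the free complex on the equations that respects all relations between
   them extends to the free complex on the unknowns. *)
Definition extends_relations A : Prop :=
  forall P0 P (f : chain_map P0 P) (b : chain_map P0 A),
    is_free P0 -> is_free P -> (forall n z, f n z = 0 -> b n z = 0) ->
    exists phi : chain_map P A, forall n z, phi n (f n z) = b n z.

(** Schanuel again. With [phi] lifting [p] along [q] and p(x_i) = q(l_i), every element of L is a
    combination of the l_i - phi(x_i) plus some phi(y). It is in ker q only if p(y) = 0, that is, y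
    comes from P0; so ker q is generated by the l_i - phi(x_i) and the images of the generators of
    P0. *)
Lemma cokernel_finitely_presented P0 P F (f : chain_map P0 P) (p : chain_map P F) :
  is_free P0 -> is_free P -> epi p -> exact_at f p -> finitely_presented F.
Proof.
move=> fr0 fr pe ex; split.
  exact: epi_finitely_generated pe (free_finitely_generated fr).
move=> L q [k [deg [l lP]]] qe.
have [phi phiP] := free_lift p fr qe.
pose x i := projT1 (cid (pe (deg i) (q _ (l i)))).
have xP i : p _ (x i) = q _ (l i) by exact: projT2 (cid (pe (deg i) (q _ (l i)))).
have [psi psiP] : exists psi : chain_map P0 (ker_complex q),
    forall n z, ckval q n (psi n z) = ccomp phi f n z.
  apply: lift_ker; [exact: ckval_mono|exact: ckval_exact|] => n z /=.
  by rewrite phiP (ses0 ex).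
have [k0 [deg0 [g0 g0P]]] := free_finitely_generated fr0.
have uP i : exists u : ker_complex q (deg i), kval u = l i - phi _ (x i).
  by apply: ker_val_exists; rewrite linearB phiP xP subrr.
pose u i := projT1 (cid (uP i)).
have uE i : kval (u i) = l i - phi _ (x i) by exact: projT2 (cid (uP i)).
pose D (i : 'I_k0 + 'I_k) : {n & ker_complex q n} := match i with
  | inl j => existT (fun n => ker_complex q n) _ (psi _ (g0 j))
  | inr j => existT (fun n => ker_complex q n) _ (u j) end.
exists (k0 + k)%N, (fun i : 'I_(k0 + k) => projT1 (D (fintype.split i))), (fun i : 'I_(k0 + k) => projT2 (D (fintype.split i))).
move=> S HS SD n z.
have S0 m w : S m (psi m w).
  apply: (g0P (fun m w => S m (psi m w))) => [|j].
    split=> [a|a b c|a b c|a b].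
    - by rewrite linear0; apply: sub_zero.
    - by rewrite linearD; apply: sub_add.
    - by rewrite linearZ; apply: sub_scale.
    - by rewrite cmapP; apply: sub_diff.
  by have := SD (unsplit (inl j)); rewrite unsplitK.
have [s [y [Ss sy]]] : exists s y, S n s /\ kval z = kval s + phi n y.
  apply: (lP (fun n v => exists s y, S n s /\ v = kval s + phi n y)) => [|i].
    split=> [m|m _ _ [s [y [Ss ->]]] [s' [y' [Ss' ->]]]|m a _ [s [y [Ss ->]]]|m _ [s [y [Ss ->]]]].
    - by exists 0, 0; rewrite linear0 addr0; split=> //; apply: sub_zero.
    - exists (s + s'), (y + y'); rewrite linearD addrACA; split=> //.
      exact: sub_add.
    - by exists (a *: s), (a *: y); rewrite linearZ scalerDr; split=> //; apply: sub_scale.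
    - exists (cdiff m s), (cdiff m y); rewrite cmapP linearD; split=> //.
      exact: sub_diff.
  exists (u i), (x i); rewrite uE subrK; split=> //.
  by have := SD (unsplit (inr i)); rewrite unsplitK.
have /ex [w wE] : p n y = 0.
  rewrite -phiP; have := congr1 (q n) sy.
  by rewrite linearD !ckvalP add0r => <-.
suff -> : z = s + psi n w by apply: sub_add.
by apply: val_inj; rewrite [LHS]sy -wE; congr (_ + _); apply: esym (psiP n w).
Qed.

(** The pushout M of [b] and [f] is an extension of coker f by A: although [f] need not be mono, A
    still embeds because [b] kills ker f. A splitting of M, restricted to P, is the extension
    sought. *)
Lemma FP_injective_extends A : FP_injective A -> extends_relations A.
Proof.
move=> FPA P0 P f b fr0 fr fb.
have [F [p [pe ex]]] := cokernel_exists f.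
pose r := cpair b (copp f).
have [M [c [ce cex]]] := cokernel_exists r.
have c0 n a q : c n (a, q) = 0 <-> exists2 z, b n z = a & f n z = - q.
  split=> [/cex [z [<- <-]]|[z <- fz]]; first by exists z; rewrite // opprK.
  by apply/cex; exists z; congr pair; rewrite /= fz opprK.
pose i := ccomp c (dsum_inl A P).
have [o oP] : exists o : chain_map M F, forall n x, o n (c n x) = ccomp p (csnd A P) n x.
  apply: (factor_epi ce) => n [a q] /c0 [z _ fz] /=.
  by rewrite -[q]opprK -fz linearN (ses0 ex) oppr0.
have im : mono i.
  apply: monoP => n a /c0 [z <- fz]; apply: fb; by rewrite fz oppr0.
have oe : epi o.
  by move=> n y; have [q <-] := pe n y; exists (c n (0, q)); rewrite oP.
have ioex : exact_at i o.
  move=> n y; have [[a q] <-] := ce n y; rewrite oP /=; split.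
    move=> /ex [z fz]; exists (a + b n z).
    apply/eqP; rewrite -subr_eq0 -linearB; apply/eqP/c0.
    exists z; first by rewrite /= [RHS]addrC addrA addNr add0r.
    by rewrite /= sub0r opprK.
  move=> [a' /eqP]; rewrite -subr_eq0 -linearB => /eqP /c0 [z _].
  by rewrite /= sub0r opprK => fz; apply/ex; exists z.
have FPF : finitely_presented F by apply: (cokernel_finitely_presented fr0 fr pe ex).
have [h [hi _]] := FPA F FPF (Extension im oe ioex).
exists (ccomp (cfst A F) (ccomp h (ccomp c (cpair (czero P A) (cident P))))) => n z /=.
have -> : c n (0, f n z) = i n (b n z).
  apply/eqP; rewrite -subr_eq0 -linearB; apply/eqP/c0; exists (- z).
    by rewrite /= linearN sub0r.
  by rewrite /= linearN subr0.
by rewrite (hi n (b n z)).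
Qed.

(** A lift P -> M of the cover of F takes values in A on the relations; extending these values over
    P and subtracting makes the lift descend to a section on F. *)
Lemma extends_FP_injective A : extends_relations A -> FP_injective A.
Proof.
move=> exA F [Ffg Fk] S.
have [P [p [fr pe]]] := fg_cover Ffg.
have [P0 [q [fr0 qe]]] := fg_cover (Fk P p (free_finitely_generated fr) pe).
have [psi psiP] := free_lift p fr (@ext_out_epi _ _ _ S).
have [b bP] : exists b : chain_map P0 A, forall n z,
    ext_in S n (b n z) = ccomp psi (ccomp (ckval p) q) n z.
  apply: lift_ker; [exact: ext_in_mono|exact: ext_exact|] => n z /=.
  by rewrite psiP ckvalP.
have [|phi phiP] := exA P0 P (ccomp (ckval p) q) b fr0 fr.
  move=> n z /= qz; apply: (@ext_in_mono _ _ _ S n).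
  by rewrite bP /= qz !linear0.
have [sg sgP] : exists sg : chain_map F (ext_mid S), forall n z,
    sg n (p n z) = csub psi (ccomp (ext_in S) phi) n z.
  apply: (factor_epi pe) => n z /ker_val_exists [k <-].
  have [w <-] := qe n k; rewrite /=.
  by have /= -> := phiP n w; rewrite bP subrr.
have sgK n y : ext_out S n (sg n y) = y.
  have [z <-] := pe n y; rewrite sgP /= linearB psiP.
  by rewrite (ses0 (@ext_exact _ _ _ S)) subr0.
have [h hP] : exists h : chain_map (ext_mid S) A, forall n x,
    ext_in S n (h n x) = csub (cident _) (ccomp sg (ext_out S)) n x.
  apply: lift_ker; [exact: ext_in_mono|exact: ext_exact|] => n x /=.
  by rewrite linearB sgK subrr.
exists (cpair h (ext_out S)); split=> //= n a.
congr pair; last exact: (ses0 (@ext_exact _ _ _ S)).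
apply: (@ext_in_mono _ _ _ S n); rewrite hP /=.
by rewrite (ses0 (@ext_exact _ _ _ S)) linear0 subr0.
Qed.

Lemma FP_injectiveP A : FP_injective A <-> extends_relations A.
Proof. by split; [apply: FP_injective_extends | apply: extends_FP_injective]. Qed.

End FreePresentations.

(** * Closure properties and orthogonality *)

Section Closure.
Context {R : pzRingType}.
Implicit Types X Y A I : complex R.

Lemma injective_FP I : injective_complex I -> FP_injective I.
Proof.
move=> injI F _ S.
have [r rP] := injI _ _ (ext_in S) (cident I) (@ext_in_mono _ _ _ S).
exists (cpair r (ext_out S)); split=> //= n a.
by congr pair; [apply: rP | apply: (ses0 (@ext_exact _ _ _ S))].
Qed.

Lemma retract_FP A X (i : chain_map A X) (r : chain_map X A) :
  (forall n a, r n (i n a) = a) -> FP_injective X -> FP_injective A.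
Proof.
move=> ri /FP_injectiveP exX; apply/FP_injectiveP => P0 P f b fr0 fr fb.
have [n z fz|phi phiP] := exX P0 P f (ccomp i b) fr0 fr.
  by rewrite /= fb // linear0.
by exists (ccomp r phi) => n z; rewrite /= phiP /= ri.
Qed.

Lemma extension_FP A X Y (i : chain_map A X) (p : chain_map X Y) :
  ses i p -> FP_injective A -> FP_injective Y -> FP_injective X.
Proof.
move=> [im pe ex] /FP_injectiveP exA /FP_injectiveP exY.
apply/FP_injectiveP => P0 P f b fr0 fr fb.
have [n z fz|phi phiP] := exY P0 P f (ccomp p b) fr0 fr.
  by rewrite /= fb // linear0.
have [psi psiP] := free_lift phi fr pe.
have [b' b'P] : exists b' : chain_map P0 A, forall n z,
    i n (b' n z) = csub b (ccomp psi f) n z.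
  by apply: (lift_ker im ex) => n z /=; rewrite linearB psiP phiP subrr.
have [n z fz|chi chiP] := exA P0 P f b' fr0 fr.
  by apply: (im n); rewrite b'P /= fz fb // !linear0 addr0.
exists (cadd psi (ccomp i chi)) => n z /=.
by rewrite chiP b'P /= addrC subrK.
Qed.

(** A lift of [b] to X need not kill ker f, but its values there lie in A. Coherence covers ker f by
    a finite free complex, so FP-injectivity of A provides a correction P0 -> A. *)
Lemma cokernel_FP (hR : left_coherent R) A X Y (i : chain_map A X) (p : chain_map X Y) :
  ses i p -> FP_injective A -> FP_injective X -> FP_injective Y.
Proof.
move=> [im pe ex] /FP_injectiveP exA /FP_injectiveP exX.
apply/FP_injectiveP => P0 P f b fr0 fr fb.
have [b' b'P] := free_lift b fr0 pe.
have [P1 [f1 [fr1 ex1]]] := coherent_kernel_cover hR f fr0 fr.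
have [b1 b1P] : exists b1 : chain_map P1 A, forall n z,
    i n (b1 n z) = ccomp b' f1 n z.
  by apply: (lift_ker im ex) => n z; rewrite /= b'P fb // (ses0 ex1).
have [n z fz|chi chiP] := exA P1 P0 f1 b1 fr1 fr0.
  by apply: (im n); rewrite b1P /= fz !linear0.
have [n z /ex1 [w <-]|phi phiP] := exX P0 P f (csub b' (ccomp i chi)) fr0 fr.
  by rewrite /= chiP b1P subrr.
exists (ccomp p phi) => n z.
by rewrite /= phiP /= linearB (ses0 ex) subr0 b'P.
Qed.

Lemma dsum_ses X Y : ses (dsum_inl X Y) (dsum_snd X Y).
Proof. by split; [apply: dsum_inl_mono | apply: dsum_snd_epi | apply: dsum_exact]. Qed.

Lemma dsum_FP X Y : FP_injective X -> FP_injective Y -> FP_injective (dsum X Y).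
Proof. exact: extension_FP (dsum_ses X Y). Qed.

Lemma dsum_injective X Y :
  injective_complex X -> injective_complex Y -> injective_complex (dsum X Y).
Proof.
move=> iX iY U V i f im.
have [g gP] := iX U V i (ccomp (cfst X Y) f) im.
have [h hP] := iY U V i (ccomp (csnd X Y) f) im.
by exists (cpair g h) => n x; rewrite /= gP hP /= -surjective_pairing.
Qed.

Lemma pow_injective X : injective_complex X -> injective_complex (pow X).
Proof.
move=> iX U V i f im.
have /choice [g gP] := fun k : nat => iX U V i (ccomp (cproj X k) f) im.
by exists (ctuple g) => n x; apply/funext => k; apply: gP.
Qed.

(** * Lifting properties against FP-injective complexes *)

Definition FP_precover X Y (p : chain_map X Y) : Prop :=
  forall A (f : chain_map A Y), FP_injective A ->
    exists g : chain_map A X, forall n a, p n (g n a) = f n a.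

(* orth X says that Ext^1(A, X) = 0 for every FP-injective complex A. *)
Definition orth X : Prop :=
  forall M A (i : chain_map X M) (p : chain_map M A),
    ses i p -> FP_injective A -> exists r : chain_map M X, forall n x, r n (i n x) = x.

Definition inj_factor X Y (f : chain_map X Y) : Prop :=
  exists I (u : chain_map X I) (v : chain_map I Y),
    injective_complex I /\ forall n x, f n x = v n (u n x).

Lemma inj_factor_extend X Y M (f : chain_map X Y) (i : chain_map X M) :
  inj_factor f -> mono i -> exists g : chain_map M Y, forall n x, g n (i n x) = f n x.
Proof.
move=> [I [u [v [iI fE]]]] im; have [u' u'P] := iI _ _ i u im.
by exists (ccomp v u') => n x; rewrite /= u'P fE.
Qed.

Lemma inj_factor_comp X Y Z U (f : chain_map X Y) (g : chain_map U X) (h : chain_map Y Z)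
    (t : chain_map U Z) :
  inj_factor f -> (forall n x, t n x = h n (f n (g n x))) -> inj_factor t.
Proof.
move=> [I [u [v [iI fE]]]] tE; exists I, (ccomp u g), (ccomp h v); split=> // n x.
by rewrite tE fE.
Qed.

Lemma inj_factor_add X Y (f g t : chain_map X Y) :
  inj_factor f -> inj_factor g -> (forall n x, t n x = f n x + g n x) -> inj_factor t.
Proof.
move=> [I [u [v [iI fE]]]] [J [u' [v' [iJ gE]]]] tE.
exists (dsum I J), (cpair u u'), (ccopair v v'); split; first exact: dsum_injective.
by move=> n x; rewrite tE fE gE.
Qed.

(** The pushout of the sequence along [t] is an extension of A by X, hence splits. *)
Lemma orth_extend X Z M A (i : chain_map Z M) (p : chain_map M A) (t : chain_map Z X) :
  orth X -> ses i p -> FP_injective A ->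
  exists g : chain_map M X, forall n z, g n (i n z) = t n z.
Proof.
move=> oX [im pe ex] FA.
have [N [c [ce cex]]] := cokernel_exists (cpair t (copp i)).
have c0 n x m : c n (x, m) = 0 <-> exists2 z, t n z = x & i n z = - m.
  split=> [/cex [z [<- <-]]|[z <- iz]]; first by exists z; rewrite // opprK.
  by apply/cex; exists z; congr pair; rewrite /= iz opprK.
have [o oP] : exists o : chain_map N A, forall n x, o n (c n x) = ccomp p (csnd X M) n x.
  apply: (factor_epi ce) => n [x m] /c0 [z _ iz] /=.
  by rewrite -[m]opprK -iz linearN (ses0 ex) oppr0.
have [|//|r rP] := @oX N A (ccomp c (dsum_inl X M)) o.
  split.
  - apply: monoP => n x /c0 [z <-]; rewrite oppr0 => iz.
    by rewrite (mono0 im iz) linear0.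
  - by move=> n y; have [m <-] := pe n y; exists (c n (0, m)); rewrite oP.
  - move=> n y; have [[x m] <-] := ce n y; rewrite oP /=; split.
      move=> /ex [z iz]; exists (x + t n z).
      apply/eqP; rewrite -subr_eq0 -linearB; apply/eqP/c0.
      exists z; first by rewrite /= [RHS]addrC addrA addNr add0r.
      by rewrite /= sub0r opprK.
    move=> [x' /eqP]; rewrite -subr_eq0 -linearB => /eqP /c0 [z _].
    by rewrite /= sub0r opprK => iz; apply/ex; exists z.
exists (ccomp r (ccomp c (cpair (czero M X) (cident M)))) => n z /=.
rewrite -[RHS]rP /=; congr (r n _).
apply/eqP; rewrite -subr_eq0 -linearB; apply/eqP/c0; exists (- z).
  by rewrite /= linearN sub0r.
by rewrite /= linearN subr0.
Qed.

(** The exact sequence Hom(A, I) -> Hom(A, X) -> Ext^1(A, K) -> Ext^1(A, I) = 0, carried out on an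
    extension: a map M -> I extending [k] is corrected by a lift of the map it induces on A. *)
Lemma orth_kernel K I X (k : chain_map K I) (y : chain_map I X) :
  mono k -> exact_at k y -> FP_precover y -> injective_complex I -> orth K.
Proof.
move=> km kex py iI M A i p [im pe ex] FA.
have [e eP] := iI _ _ i k im.
have [a aP] : exists a : chain_map A X, forall n m, a n (p n m) = ccomp y e n m.
  by apply: (factor_coker pe ex) => n x; rewrite /= eP (ses0 kex).
have [a' a'P] := py A a FA.
have [r rP] : exists r : chain_map M K, forall n m,
    k n (r n m) = csub e (ccomp a' p) n m.
  by apply: (lift_ker km kex) => n m; rewrite /= linearB a'P aP subrr.
exists r => n x; apply: (km n).
by rewrite rP /= eP (ses0 ex) linear0 subr0.
Qed.

(** The obstruction to lifting A -> X' is the pullback extension N of A by X, which splits. *)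
Lemma orth_precover X I X' (i : chain_map X I) (p : chain_map I X') :
  orth X -> ses i p -> FP_precover p.
Proof.
move=> oX [im pe ex] A a FA.
pose d := csub (ccomp p (cfst I A)) (ccomp a (csnd I A)).
have [N [k [km kex]]] := kernel_exists d.
have [al alP] : exists al : chain_map X N, forall n x,
    k n (al n x) = cpair i (czero X A) n x.
  by apply: (lift_ker km kex) => n x; rewrite /= (ses0 ex) linear0 subrr.
pose be := ccomp (csnd I A) k.
have kP n w : p n (k n w).1 = a n (k n w).2.
  by have /eqP := ses0 kex w; rewrite subr_eq0 => /eqP.
have bee : epi be.
  move=> n x; have [z pz] := pe n (a n x).
  have /kex [w wE] : d n (z, x) = 0 by rewrite /= pz subrr.
  by exists w; rewrite /= wE.
have bex : exact_at al be.
  move=> n w; split=> [w2|[x <-]]; last by rewrite /= alP.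
  have /ex [x ix] : p n (k n w).1 = 0 by rewrite kP [X in a n X]w2 linear0.
  exists x; apply: (km n).
  by rewrite alP [k n w]surjective_pairing; congr pair.
have alm : mono al.
  apply: monoP => n x alx; apply: (mono0 im).
  by have := alP n x; rewrite alx linear0 => -[<-].
have [|r rP] := oX _ _ al be _ FA; first by split.
have [s sP] : exists s : chain_map A I, forall n w,
    s n (be n w) = csub (ccomp (cfst I A) k) (ccomp i r) n w.
  by apply: (factor_coker bee bex) => n x; rewrite /= rP alP subrr.
exists s => n x; have [w <-] := bee n x.
by rewrite sP /= linearB (ses0 ex) subr0 kP.
Qed.

Lemma cokernel_of_injective X : exists I X' (i : chain_map X I) (p : chain_map I X'),
  injective_complex I /\ ses i p.
Proof.
have [I [i [iI im]]] := enough_injectives X.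
have [X' [p [pe ex]]] := cokernel_exists i.
by exists I, X', i, p; split.
Qed.
End Closure.

(** * Summands up to FP-injectives *)

Section StableRetracts.
Context {R : pzRingType} (hR : left_coherent R).
Implicit Types X Y A I : complex R.

(* X = (I + D)/C is FP-injective, so the map X -> H' induced by pi lifts to
   s : X -> D; then (i, d) |-> d - s[i, d] lands in H and gives y and w. *)
Lemma factor_through_precover_injective H D H' C I (q : chain_map H D)
    (pi : chain_map D H') (c : chain_map C H) (j : chain_map C I) :
  ses q pi -> FP_precover pi -> FP_injective D -> FP_injective C ->
  injective_complex I -> mono j ->
  exists (y : chain_map I H) (w : chain_map D H),
    forall n z, c n z = y n (j n z) + w n (q n (c n z)).
Proof.
move=> [qm pie ex] ppi FD FC iI jm.
pose m := cpair j (ccomp q c).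
have [X [p [pe pex]]] := cokernel_exists m.
have FX : FP_injective X.
  apply: (cokernel_FP hR (i := m) (p := p)) => //; last first.
    by apply: dsum_FP => //; apply: injective_FP.
  by split=> //; apply: monoP => n z /= [jz _]; apply: (mono0 jm).
have [s0 s0P] : exists s0 : chain_map X H', forall n u,
    s0 n (p n u) = ccomp pi (csnd I D) n u.
  by apply: (factor_coker pe pex) => n z; rewrite /= (ses0 ex).
have [s sP] := ppi X s0 FX.
have [T TP] : exists T : chain_map (dsum I D) H, forall n u,
    q n (T n u) = csub (csnd I D) (ccomp s p) n u.
  by apply: (lift_ker qm ex) => n u; rewrite /= linearB sP s0P subrr.
exists (ccomp T (dsum_inl I D)), (ccomp T (cpair (czero D I) (cident D))) => n z.
have e : dsum_inl I D n (j n z) + cpair (czero D I) (cident D) n (q n (c n z)) = m n z.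
  by congr pair; rewrite /= ?addr0 ?add0r.
apply: (qm n); rewrite [RHS](_ : _ = q n (T n (m n z))).
  by rewrite TP /= (ses0 pex) linear0 subr0.
by congr (q n _); rewrite -e linearD.
Qed.

(* X is a direct summand of W + F, with F FP-injective. *)
Definition stable_retract X W : Prop :=
  exists F (lam : chain_map X W) (mu : chain_map W X) (del : chain_map X F)
      (rho : chain_map F X),
    FP_injective F /\ forall n x, x = mu n (lam n x) + rho n (del n x).

Lemma retract_stable X W (i : chain_map X W) (r : chain_map W X) :
  (forall n x, r n (i n x) = x) -> stable_retract X W.
Proof.
move=> ri; have [I [_ [iI _]]] := enough_injectives X.
exists I, i, r, (czero _ _), (czero _ _); split; first exact: injective_FP.
by move=> n x; rewrite ri /= addr0.
Qed.

Lemma stable_retract_trans X Y Z :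
  stable_retract X Y -> stable_retract Y Z -> stable_retract X Z.
Proof.
move=> [F [l [m [d [r [FF E]]]]]] [F' [l' [m' [d' [r' [FF' E']]]]]].
exists (dsum F F'), (ccomp l' l), (ccomp m m'), (cpair d (ccomp d' l)),
  (ccopair r (ccomp m r')); split; first exact: dsum_FP.
move=> n x; rewrite /= [x in LHS]E [l n x in LHS]E' linearD.
by rewrite -addrA; congr (_ + _); rewrite addrC.
Qed.

(* With pi = y j + w q' pi and lifts of y and w along pi, one gets
   q (1 - g q) = (lift of y) j q for some g : D -> W.  Hence 1 - g q acts as zero
   on Ext^1(A, W), while g q does so on X because maps from D to X factor
   through injectives. *)
Lemma stable_retract_orth W D H D' H2 X
    (q : chain_map W D) (pi : chain_map D H) (q' : chain_map H D')
    (pi' : chain_map D' H2) :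
  ses q pi -> FP_precover pi -> FP_injective D ->
  ses q' pi' -> FP_precover pi' -> FP_injective D' ->
  stable_retract X W ->
  (forall F (f : chain_map F X), FP_injective F -> inj_factor f) -> orth X.
Proof.
move=> qpi ppi FD qpi' ppi' FD' [F [lam [mu [del [rho [FF lmE]]]]]] facX M A al be
  [alm bee abex] FA.
have [I [j [iI jm]]] := enough_injectives D.
have [y [w yw]] := factor_through_precover_injective pi qpi' ppi' FD' FD iI jm.
have [yy yyP] := ppi I y (injective_FP iI).
have [ww wwP] := ppi D' w FD'.
have [qm _ ex] := qpi.
have [g gP] : exists g : chain_map D W, forall n d,
    q n (g n d) = csub (cident D) (cadd (ccomp yy j) (ccomp ww (ccomp q' pi))) n d.
  by apply: (lift_ker qm ex) => n d; rewrite /= linearB linearD yyP wwP {1}yw subrr.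
have [t2 t2P] : exists t2 : chain_map M X, forall n x,
    t2 n (al n x) = mu n (g n (q n (lam n x))).
  have [|t2 t2P] := @inj_factor_extend _ _ _ M (ccomp mu (ccomp g (ccomp q lam))) al _ alm.
    by apply: (@inj_factor_comp _ _ _ _ _ (ccomp mu g) (ccomp q lam) (cident X)) => //;
       apply: facX.
  by exists t2.
have [t3 t3P] : exists t3 : chain_map M X, forall n x,
    t3 n (al n x) = rho n (del n x).
  have [|t3 t3P] := @inj_factor_extend _ _ _ M (ccomp rho del) al _ alm.
    by apply: (@inj_factor_comp _ _ _ _ _ rho del (cident X)) => //; apply: facX.
  by exists t3.
have [e eP] := iI _ _ al (ccomp j (ccomp q lam)) alm.
have tP n x : yy n (e n (al n x)) = q n (lam n x - g n (q n (lam n x))).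
  by rewrite eP /= linearB gP /= (ses0 ex) !linear0 addr0 opprB addrCA subrr addr0.
(* Modulo the image of [q], the map [yy e] comes from A; subtracting a lift of it makes the map land
   in W and changes nothing on X. *)
have [a aP] : exists a : chain_map A H, forall n m, a n (be n m) =
    ccomp pi (ccomp yy e) n m.
  by apply: (factor_coker bee abex) => n x; rewrite /= tP (ses0 ex).
have [a' a'P] := ppi A a FA.
have [t' t'P] : exists t' : chain_map M W, forall n m,
    q n (t' n m) = csub (ccomp yy e) (ccomp a' be) n m.
  by apply: (lift_ker qm ex) => n m; rewrite /= linearB a'P aP subrr.
exists (cadd (ccomp mu t') (cadd t2 t3)) => n x /=.
have -> : t' n (al n x) = lam n x - g n (q n (lam n x)).
  by apply: (qm n); rewrite t'P /= (ses0 abex) linear0 subr0 tP.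
by rewrite t2P t3P linearB addrA subrK -lmE.
Qed.

(** H = D/W and W' = I/W are two cosyzygies of W. The map [j] induces H -> W', and [y] induces W' ->
    H because pi = y j + w q' pi shows that it kills W. The defect of W' -> H -> W' from the
    identity factors through (I + D')/D, which is FP-injective by coherence. *)
Lemma cosyzygy_stable_retract W D H D' H2 I W'
    (q : chain_map W D) (pi : chain_map D H) (q' : chain_map H D')
    (pi' : chain_map D' H2) (j : chain_map D I) (tau : chain_map I W') :
  ses q pi -> FP_injective D -> ses q' pi' -> FP_precover pi' -> FP_injective D' ->
  injective_complex I -> mono j -> epi tau -> exact_at (ccomp j q) tau ->
  stable_retract W' H.
Proof.
move=> [qm pie ex] FD qpi' ppi' FD' iI jm taue tauex.
have [y [w yw]] := factor_through_precover_injective pi qpi' ppi' FD' FD iI jm.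
have [lam lamP] : exists lam : chain_map W' H, forall n i, lam n (tau n i) = y n i.
  apply: (factor_coker taue tauex) => n x /=.
  by have := yw n (q n x); rewrite (ses0 ex) !linear0 addr0 => <-.
have [mu muP] : exists mu : chain_map H W', forall n d,
    mu n (pi n d) = ccomp tau j n d.
  by apply: (factor_coker pie ex) => n x; exact: (ses0 tauex).
pose m := cpair j (ccomp q' pi).
have [X [p [pe pex]]] := cokernel_exists m.
have FX : FP_injective X.
  apply: (cokernel_FP hR (i := m) (p := p)) => //; last first.
    by apply: dsum_FP => //; apply: injective_FP.
  by split=> //; apply: monoP => n z /= [jz _]; apply: (mono0 jm).
have [Th ThP] : exists Th : chain_map X W', forall n u, Th n (p n u) =
    ccopair (csub tau (ccomp mu y)) (copp (ccomp mu w)) n u.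
  apply: (factor_coker pe pex) => n z /=.
  rewrite -addrA -opprD -linearD -yw muP; exact: subrr.
have [del delP] : exists del : chain_map W' X, forall n i,
    del n (tau n i) = ccomp p (dsum_inl I D') n i.
  apply: (factor_coker taue tauex) => n x /=; apply/pex; exists (q n x).
  by congr pair; rewrite /= (ses0 ex) linear0.
exists X, lam, mu, del, Th; split=> // n x; have [i <-] := taue n x.
by rewrite lamP delP /= ThP /= !linear0 addr0 addrC subrK.
Qed.

(** The comparison maps lift to the precovers. The error 1 - mh lh - rh d cX on [CX] lands in K, and
    its last term dies on K, so on kernels the defect factors through [CX]. *)
Lemma syzygy_stable_retract X W CX CW K K' (cX : chain_map CX X) (cW : chain_map CW W)
    (k : chain_map K CX) (k' : chain_map K' CW) :
  stable_retract X W -> FP_injective CX -> FP_injective CW ->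
  FP_precover cX -> FP_precover cW -> mono k -> exact_at k cX -> mono k' -> exact_at k' cW ->
  stable_retract K K'.
Proof.
move=> [F [l [m [d [r [FF E]]]]]] FX FW pX pW km kex km' kex'.
have [lh lhP] := pW CX (ccomp l cX) FX.
have [mh mhP] := pX CW (ccomp m cW) FW.
have [rh rhP] := pX F r FF.
have [ka kaP] : exists ka : chain_map CX K, forall n z, k n (ka n z) =
    csub (cident CX) (cadd (ccomp mh lh) (ccomp rh (ccomp d cX))) n z.
  apply: (lift_ker km kex) => n z.
  by rewrite /= linearB linearD mhP /= lhP rhP /= -E subrr.
have [l' l'P] : exists l' : chain_map K K', forall n x, k' n (l' n x) = ccomp lh k n x.
  by apply: (lift_ker km' kex') => n x; rewrite /= lhP /= (ses0 kex) linear0.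
have [m' m'P] : exists m' : chain_map K' K, forall n x, k n (m' n x) = ccomp mh k' n x.
  by apply: (lift_ker km kex) => n x; rewrite /= mhP /= (ses0 kex') linear0.
exists CX, l', m', k, ka; split=> // n x; apply: (km n).
rewrite linearD m'P kaP /= l'P /= (ses0 kex) !linear0 addr0.
by rewrite addrCA subrr addr0.
Qed.

(** Dual to the comparison of syzygies. The part through F induces a part through a cosyzygy F' of
    F, FP-injective by coherence; the error of the chosen extensions factors through [IX]. *)
Lemma cosyzygy_functor X W IX IW X' W' (iX : chain_map X IX) (pX : chain_map IX X')
    (iW : chain_map W IW) (pW : chain_map IW W') :
  stable_retract X W -> injective_complex IX -> injective_complex IW ->
  ses iX pX -> ses iW pW -> stable_retract X' W'.
Proof.
move=> [F [l [m [d [r [FF E]]]]]] JX JW [iXm pXe Xex] [iWm pWe Wex].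
have [IF [F' [iF [pF [JF [iFm pFe Fex]]]]]] := cokernel_of_injective F.
have FF' : FP_injective F'.
  by apply: (cokernel_FP hR (i := iF) (p := pF)) => //; apply: injective_FP.
have ext U V IU IV U' V' (iU : chain_map U IU) (pU : chain_map IU U')
    (iV : chain_map V IV) (pV : chain_map IV V') (f : chain_map U V) :
    mono iU -> epi pU -> exact_at iU pU -> injective_complex IV -> exact_at iV pV ->
    exists (fh : chain_map IU IV) (f' : chain_map U' V'),
      (forall n x, fh n (iU n x) = iV n (f n x)) /\
      (forall n z, f' n (pU n z) = pV n (fh n z)).
  move=> iUm pUe Uex JV Vex; have [fh fhP] := JV _ _ iU (ccomp iV f) iUm.
  have [f' f'P] : exists f' : chain_map U' V', forall n z,
      f' n (pU n z) = ccomp pV fh n z.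
    by apply: (factor_coker pUe Uex) => n x; rewrite /= fhP /= (ses0 Vex).
  by exists fh, f'.
have [lh [l' [lhP l'P]]] := ext _ _ _ _ _ _ _ iX pX iW pW l iXm pXe Xex JW Wex.
have [mh [m' [mhP m'P]]] := ext _ _ _ _ _ _ _ iW pW iX pX m iWm pWe Wex JX Xex.
have [dh [d' [dhP d'P]]] := ext _ _ _ _ _ _ _ iX pX iF pF d iXm pXe Xex JF Fex.
have [rh [r' [rhP r'P]]] := ext _ _ _ _ _ _ _ iF pF iX pX r iFm pFe Fex JX Xex.
have [th thP] : exists th : chain_map X' IX, forall n z, th n (pX n z) =
    csub (cident IX) (cadd (ccomp mh lh) (ccomp rh dh)) n z.
  apply: (factor_coker pXe Xex) => n x.
  by rewrite /= lhP dhP mhP rhP -linearD -E subrr.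
exists (dsum F' IX), l', m', (cpair d' th), (ccopair r' pX).
split; first by apply: dsum_FP => //; apply: injective_FP.
move=> n x; have [z <-] := pXe n x.
rewrite /= l'P m'P d'P r'P thP /= linearB linearD.
by rewrite addrA [RHS]addrC subrK.
Qed.

End StableRetracts.

(** * Splitting idempotents modulo injectives *)

Section Resolutions.
Context {R : pzRingType} (hR : left_coherent R).
Implicit Types X Y A I : complex R.

Definition biresolved (C W : complex R -> Prop) : Prop :=
  forall X, W X ->
    (exists (K A : complex R) (k : chain_map K A) (c : chain_map A X),
      [/\ W K, C A, ses k c & FP_precover c]) /\
    (exists (A H : complex R) (q : chain_map X A) (p : chain_map A H),
      [/\ W H, C A, ses q p & FP_precover p]).

Definition orth_stable_retract (W : complex R -> Prop) X : Prop :=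
  orth X /\ exists W0, W W0 /\ stable_retract X W0.

(** To the left, a precover of W0 and the defect term F combine to a precover of X by C0 + F.
    Embedding C0 + F in an injective I, Ext^1(I/(C0 + F), X) = 0 extends it to I -> X, still a
    precover. To the right, any embedding of X in an injective serves; the work is to show that its
    cokernel stays in the class. *)
Lemma orth_biresolved W : biresolved (@FP_injective R) W ->
  biresolved (@injective_complex R) (orth_stable_retract W).
Proof.
move=> bW X [oX [W0 [WW0 sX]]]; split.
  have [[K0 [C0 [k0 [c0 [WK0 FC0 [k0m c0e kex0] pc0]]]]] _] := bW W0 WW0.
  have [F [l [m [d [r [FF E]]]]]] := sX.
  pose c := ccopair (ccomp m c0) r.
  have [I [B [j [b [iI jb]]]]] := cokernel_of_injective (dsum C0 F).
  have FC : FP_injective (dsum C0 F) by apply: dsum_FP.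
  have FI := injective_FP iI.
  have [y yj] := orth_extend c oX jb (cokernel_FP hR jb FC FI).
  have py : FP_precover y.
    move=> A f FA.
    have [g gP] := pc0 A (ccomp l f) FA.
    exists (ccomp j (cpair g (ccomp d f))) => n a.
    by rewrite /= yj /= gP /= -E.
  have ye : epi y.
    move=> n x; have [z zP] := c0e n (l n x).
    by exists (j n (z, d n x)); rewrite yj /= zP -E.
  have [K [k [km kex]]] := kernel_exists y.
  exists K, I, k, y; split=> //; split; first exact: orth_kernel km kex py iI.
  exists K0; split=> //.
  exact: (syzygy_stable_retract sX FI FC0 py pc0 km kex k0m kex0).
(* Three steps are needed: X' is compared with [H], and [stable_retract_orth] then uses the two
   steps to the right of [H]. *)
have [_ [D [H [q [p [WH FD qp pp]]]]]] := bW W0 WW0.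
have [_ [D' [H' [q' [p' [WH' FD' qp' pp']]]]]] := bW H WH.
have [_ [D'' [H'' [q'' [p'' [_ FD'' qp'' pp'']]]]]] := bW H' WH'.
have [IX [X' [iX [pX [JX iXpX]]]]] := cokernel_of_injective X.
have [J [j [JJ jm]]] := enough_injectives D.
have [W' [tau [taue tauex]]] := cokernel_exists (ccomp j q).
have sX' : stable_retract X' H.
  apply: stable_retract_trans (cosyzygy_functor hR sX JX JJ iXpX (iW := ccomp j q) (pW := tau) _) _.
    by split=> // n x x' /jm; case: qp => qm _ _ /qm.
  exact: (cosyzygy_stable_retract hR qp FD qp' pp' FD' JJ jm taue tauex).
have pp0 := orth_precover oX iXpX.
exists IX, X', iX, pX; split=> //; split; last by exists H.
apply: (stable_retract_orth hR qp' pp' FD' qp'' pp'' FD'' sX') => F f FF.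
have [g gP] := pp0 F f FF.
by exists IX, g, pX; split=> // n a; rewrite gP.
Qed.

Section Splitting.
Context {G K C D H : complex R} {k : chain_map K C} {c : chain_map C G}
  {q : chain_map G D} {p : chain_map D H}.
Context (pc : FP_precover c) (FC : FP_injective C)
  (qp : ses q p) (pp : FP_precover p) (FD : FP_injective D).

(* h = w q factors through D, and its complement e = 1 - h is idempotent
   modulo injectives since e kills, modulo injectives, maps from FP-injectives. *)
Lemma idempotent_mod_injectives :
  exists (I : complex R) (h e : chain_map G G) (u : chain_map G I) (y : chain_map I G)
    (w : chain_map D G),
    [/\ injective_complex I, forall n x, e n x = x - h n x,
        forall n x, y n (u n x) = e n (h n x), forall n x, h n x = w n (q n x) &
        forall A (f : chain_map A G), FP_injective A ->
          exists g : chain_map A I, forall n a, e n (f n a) = y n (g n a)].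
Proof.
have [I [j [iI jm]]] := enough_injectives C.
have [y [w yw]] := factor_through_precover_injective hR c qp pp FD FC iI jm.
have [ww wwP] := pc w FD.
pose h := ccomp w q; pose e := csub (cident G) h.
(* On C, [e] factors through I, hence so does its composite with whatever lifts to C: maps from
   FP-injectives, and [h] itself, since [w] lifts along [c]. *)
have ec n z : e n (c n z) = y n (j n z) by rewrite /= {1}yw addrK.
exists I, h, e, (ccomp j (ccomp ww q)), y, w; split=> // [n x|A f FA].
  by rewrite -ec /= wwP.
have [g gP] := pc f FA; exists (ccomp j g) => n a.
by rewrite -gP ec.
Qed.
End Splitting.

(** * The swindle *)

Section SplitIdempotent.
Context {G I : complex R} (h e : chain_map G G) (u : chain_map G I) (y : chain_map I G).
Context (iI : injective_complex I) (eE : forall n x, e n x = x - h n x)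
  (eh : forall n x, y n (u n x) = e n (h n x)).

Let hD n x : h n x + e n x = x. Proof. by rewrite eE addrC subrK. Qed.
Let he n x : h n (e n x) = y n (u n x).
Proof. by rewrite eh !eE linearB. Qed.

(** The entry of index k - 1, with the convention that the entry of index -1 is 0. *)
Definition prev (k : nat) : chain_map (pow G) G :=
  if k is k'.+1 then cproj G k' else czero _ _.

Definition second_difference (k : nat) : chain_map (pow G) G :=
  cadd (csub (prev k) (cproj G k)) (csub (cproj G k.+1) (cproj G k)).

(* With r = h + e . (left shift) and s = h + e . (right shift) on G^N one has
   r s = 1 + eh . (second difference), so (s, u . difference) is a section of
   (r, -y); the kernel of the latter splits e. *)
Definition swindle : chain_map (dsum (pow G) (pow I)) (pow G) :=
  ctuple (fun k => csub
    (ccomp (cadd (ccomp h (cproj G k)) (ccomp e (cproj G k.+1))) (cfst _ _))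
    (ccomp (ccomp y (cproj I k)) (csnd _ _))).

Definition swindle_section : chain_map (pow G) (dsum (pow G) (pow I)) :=
  cpair (ctuple (fun k => cadd (ccomp e (prev k)) (ccomp h (cproj G k))))
    (ctuple (fun k => ccomp u (second_difference k))).

Let regroup (V : zmodType) (a b d f g : V) :
  a + b + (d + f) - (a - g + (f - g)) = (b + g) + (g + d).
Proof.
have -> : a + b + (d + f) = (a + f) + (b + d) by rewrite (addrC d) addrACA.
have -> : a - g + (f - g) = (a + f) - (g + g) by rewrite addrACA opprD.
by rewrite opprB addrC addrA subrK addrACA [g + b]addrC.
Qed.

Let heC n x : h n (e n x) = e n (h n x). Proof. by rewrite he eh. Qed.

Lemma swindle_sectionK n z : swindle n (swindle_section n z) = z.
Proof.
apply/funext => k; rewrite /= eh.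
rewrite !(linearB (h n), linearB (e n), linearD (h n), linearD (e n)) !heC regroup.
by rewrite hD -linearD !hD.
Qed.

Context {L : complex R} {ka : chain_map L (dsum (pow G) (pow I))}
  (kam : mono ka) (kaex : exact_at ka swindle).

Let zz k : chain_map L G := ccomp (cproj G k) (ccomp (cfst _ _) ka).
Let ii k : chain_map L I := ccomp (cproj I k) (ccomp (csnd _ _) ka).

Let rel n x k : h n (zz k n x) + e n (zz k.+1 n x) = y n (ii k n x).
Proof.
have := congr1 (fun f => f k) (ses0 kaex x).
by rewrite [LHS]/(_ - _) => /eqP; rewrite subr_eq0 => /eqP.
Qed.

(** Modulo injectives, applying [e] and [h] to the relation h z_k + e z_(k+1) = y i_k gives e
    z_(k+1) = 0 and h z_k = 0, so only the [e]-part of z_0 survives. The exact error terms are kept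
    because all entries must factor at once: each uses one copy of I + I, and the power of it is
    injective. *)
Let e_later n x k : e n (zz k.+1 n x) =
  e n (y n (ii k n x)) + y n (u n (zz k.+1 n x - zz k n x)).
Proof.
rewrite -rel (linearD (e n)) eh !(linearB (h n), linearB (e n)) addrC addrA subrK.
by rewrite -linearD hD.
Qed.

Let h_zz n x k : h n (zz k n x) = (y n (ii k n x) - e n (y n (ii k n x))) -
  y n (u n (zz k.+1 n x - zz k n x)).
Proof. by rewrite -addrA -opprD -e_later -rel addrK. Qed.

Let later n x k : zz k.+1 n x =
  y n (ii k.+1 n x + u n (zz k.+1 n x - zz k n x - (zz k.+2 n x - zz k.+1 n x))) +
  e n (y n (ii k n x - ii k.+1 n x)).
Proof.
rewrite -[LHS]hD h_zz e_later (linearD (y n)).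
set a := y n (ii k.+1 n x); set b := y n (ii k n x).
rewrite [u n (_ - (_ - _))]linearB [y n (_ - _)]linearB.
rewrite !(linearB (y n), linearB (e n)) -/a -/b.
set c := y n (u n _); set d := y n (u n _).
rewrite -!addrA; congr (_ + _); rewrite addrC !addrA; congr (_ - _).
by rewrite addrC addrA.
Qed.

Let first : chain_map G (dsum (pow G) (pow I)) :=
  cpair (ctuple (fun k : nat => if k is 0%N then cident G else czero G G)) (czero _ _).

Let rest_inj_factor : inj_factor (csub ka (ccomp first (zz 0))).
Proof.
pose al (k : nat) : chain_map L (dsum I I) := cpair
  (cadd (ii k.+1) (ccomp u (csub (csub (zz k.+1) (zz k)) (csub (zz k.+2) (zz k.+1)))))
  (csub (ii k) (ii k.+1)).
pose be : chain_map (pow (dsum I I)) (pow G) := ctuple (fun k : nat =>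
  if k is k'.+1 then ccomp (ccopair y (ccomp e y)) (cproj _ k') else czero _ _).
exists (dsum (pow (dsum I I)) (pow I)), (cpair (ctuple al) (ccomp (csnd _ _) ka)),
  (cpair (ccomp be (cfst _ _)) (csnd _ _)).
split; first by do ?[apply: dsum_injective | apply: pow_injective].
move=> n x; congr pair; last by rewrite /= subr0.
apply/funext => -[|k]; first exact: subrr.
by apply: etrans (subr0 _) _; apply: (later x k).
Qed.

Let h_zz0_inj_factor : inj_factor (ccomp h (zz 0)).
Proof.
exists (dsum I I), (cpair (csub (ii 0) (ccomp u (csub (zz 1) (zz 0)))) (ii 0)),
  (ccopair y (copp (ccomp e y))).
split; first exact: dsum_injective.
move=> n x; rewrite [LHS](h_zz x 0) /= (linearB (y n)).
by rewrite -addrA [- _ - _]addrC addrA.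
Qed.

(** [lam] is the entry of index 0; [mu] includes G at index 0 and projects to the kernel along
    [swindle_section]. Then [mu lam] is 1 up to the injective part carried by all other entries. *)
Lemma swindle_splits : exists (lam : chain_map L G) (mu : chain_map G L) (r : chain_map L L),
  [/\ forall n x, x = mu n (lam n x) + r n x, inj_factor r,
      forall n x, lam n (mu n x) = x - h n (h n x) & inj_factor (ccomp h lam)].
Proof.
have [P kaP0] : exists P : chain_map (dsum (pow G) (pow I)) L, forall n v,
    ka n (P n v) = csub (cident _) (ccomp swindle_section swindle) n v.
  apply: (lift_ker kam kaex) => n v.
  rewrite [csub _ _ n v]/(v - swindle_section n (swindle n v)).
  by rewrite linearB swindle_sectionK subrr.
have kaP n v : ka n (P n v) = v - swindle_section n (swindle n v) by exact: kaP0.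
have Pka n x : P n (ka n x) = x.
  by apply: kam; rewrite kaP (ses0 kaex) linear0 subr0.
have E n x : x = P n (first n (zz 0 n x)) + P n (ka n x - first n (zz 0 n x)).
  by rewrite linearB addrCA subrr addr0 Pka.
(* The zeros are the entry of index -1 of a sequence, the entry of index 1 of the included element
   and its component in I^N. *)
have E0 n x : x - (e n 0 + h n (h n x + e n 0 - y n 0)) = x - h n (h n x).
  by rewrite !linear0 add0r !addr0.
exists (zz 0), (ccomp P first), (ccomp P (csub ka (ccomp first (zz 0)))); split=> //.
- by apply: (@inj_factor_comp _ _ _ _ _ _ (cident L) P _ rest_inj_factor).
- move=> n x; apply: etrans (E0 n x).
  by rewrite [LHS]/((ka n (P n (first n x))).1 0%N) kaP.
Qed.
End SplitIdempotent.

(** The defect 1 - lam mu is h h = (w q) h, which factors through the FP-injective complex D. *)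
Lemma stable_splitting W G : biresolved (@FP_injective R) W -> W G ->
  exists (L I F : complex R) (lam : chain_map L G) (mu : chain_map G L)
    (al : chain_map L I) (be : chain_map I L) (del : chain_map G F) (rho : chain_map F G),
  [/\ injective_complex I /\ FP_injective F,
      forall n x, x = mu n (lam n x) + be n (al n x),
      forall n x, x = lam n (mu n x) + rho n (del n x) &
      forall A (f : chain_map A L), FP_injective A -> inj_factor f].
Proof.
move=> bW WG.
have [[K [C [k [c [_ FC _ pc]]]]] [D [H [q [p [_ FD qp pp]]]]]] := bW G WG.
have [I [h [e [u [y [w [iI eE eh hE facG]]]]]]] :=
  idempotent_mod_injectives pc FC qp pp FD.
have [L [ka [kam kaex]]] := kernel_exists (swindle h e y).
have [lam [mu [r [mlE [J [al [be [iJ rE]]]] lmE hl]]]] := swindle_splits iI eE eh kam kaex.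
exists L, J, D, lam, mu, al, be, (ccomp q h), w; split=> // [n x|n x|A f FA].
- by rewrite -rE -mlE.
- by rewrite lmE /= -hE subrK.
have [g gP] := facG A (ccomp lam f) FA.
(* In lam f = e lam f + h lam f the first term factors through I as the source is FP-injective, the
   second because [h lam] already does. *)
have le : inj_factor (ccomp lam f).
  apply: (@inj_factor_add _ _ _ (ccomp y g) (ccomp (ccomp h lam) f)).
  - by exists I, g, y.
  - exact: (@inj_factor_comp _ _ _ _ _ _ f (cident G) _ hl).
  - by move=> n x; rewrite /= -gP eE subrK.
apply: (@inj_factor_add _ _ _ (ccomp mu (ccomp lam f)) (ccomp r f)).
- exact: (@inj_factor_comp _ _ _ _ _ _ (cident A) mu _ le).
- by exists J, (ccomp al f), be; split=> // n x; rewrite /= rE.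
- by move=> n x; rewrite /= -mlE.
Qed.
End Resolutions.

(** * The exchange property *)

Section Exchange.
Context {R : pzRingType}.
Implicit Types X Y L B G I : complex R.

Lemma zero_subcomplex X : is_subcomplex (fun n (x : X n) => x = 0).
Proof.
split=> [//|n _ _ -> ->|n a _ ->|n _ ->].
- by rewrite addr0.
- by rewrite scaler0.
- by rewrite linear0.
Qed.

Lemma sum_subcomplex X (S T : forall n, X n -> Prop) :
  is_subcomplex S -> is_subcomplex T ->
  is_subcomplex (fun n x => exists s t, [/\ S n s, T n t & x = s + t]).
Proof.
move=> HS HT; split=> [n|n _ _ [s [t [Ss Tt ->]]] [s' [t' [Ss' Tt' ->]]]
  |n a _ [s [t [Ss Tt ->]]]|n _ [s [t [Ss Tt ->]]]].
- by exists 0, 0; rewrite addr0; split=> //; apply: sub_zero.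
- by exists (s + s'), (t + t'); rewrite addrACA; split=> //; apply: sub_add.
- by exists (a *: s), (a *: t); rewrite scalerDr; split=> //; apply: sub_scale.
- by exists (cdiff n s), (cdiff n t); rewrite linearD; split=> //; apply: sub_diff.
Qed.

Lemma map_subcomplex X Y Z (f : chain_map X Y) (g : chain_map X Z)
    (S : forall n, Y n -> Prop) :
  is_subcomplex S -> is_subcomplex (fun n z => exists x, S n (f n x) /\ z = g n x).
Proof.
move=> HS; split=> [n|n _ _ [x [Sx ->]] [y [Sy ->]]|n a _ [x [Sx ->]]|n _ [x [Sx ->]]].
- by exists 0; rewrite !linear0; split=> //; apply: sub_zero.
- by exists (x + y); rewrite !linearD; split=> //; apply: sub_add.
- by exists (a *: x); rewrite !linearZ; split=> //; apply: sub_scale.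
- by exists (cdiff n x); rewrite !cmapP; split=> //; apply: sub_diff.
Qed.

(** Zorn's lemma runs over subsets of the disjoint union of all [L n] and [B n], which code pairs of
    subcomplexes. Only complements of ker sg of the form S1 + S2 split into a summand of L and one
    of B. *)
Lemma maximal_independent L B G (sg : chain_map (dsum L B) G) :
  exists (S1 : forall n, L n -> Prop) (S2 : forall n, B n -> Prop),
  let indep (T1 : forall n, L n -> Prop) (T2 : forall n, B n -> Prop) :=
    forall n l b, T1 n l -> T2 n b -> sg n (l, b) = 0 -> l = 0 /\ b = 0 in
  [/\ is_subcomplex S1, is_subcomplex S2, indep S1 S2 &
      forall T1 T2, is_subcomplex T1 -> is_subcomplex T2 -> indep T1 T2 ->
        (forall n l, S1 n l -> T1 n l) -> (forall n b, S2 n b -> T2 n b) ->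
        (forall n l, T1 n l -> S1 n l) /\ (forall n b, T2 n b -> S2 n b)].
Proof.
pose T := ({n & L n} + {n & B n})%type.
pose inL (X : set T) n l := X (inl (existT (fun n => L n) n l)).
pose inB (X : set T) n b := X (inr (existT (fun n => B n) n b)).
pose good (X : set T) := [/\ is_subcomplex (inL X), is_subcomplex (inB X) &
  forall n l b, inL X n l -> inB X n b -> sg n (l, b) = 0 -> l = 0 /\ b = 0].
have [|F Fgood [A FA] totF|X [[XL XB Xi] Xmax]] := @Zorn_nonempty T good.
- exists (fun x : T => match x with inl p => projT2 p = 0 | inr p => projT2 p = 0 end).
  by split; [apply: zero_subcomplex | apply: zero_subcomplex | move=> n l b; split].
- have both x y : (\bigcup_(X in F) X)%classic x -> (\bigcup_(X in F) X)%classic y ->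
      exists2 X, F X & X x /\ X y.
    move=> [X FX Xx] [Y FY Yy]; have [XY|YX] := totF X Y FX FY.
      by exists Y => //; split=> //; apply: XY.
    by exists X => //; split=> //; apply: YX.
  split.
  + split=> [n|n x y Ux Uy|n a x [X FX Xx]|n x [X FX Xx]].
    * by exists A => //; case: (Fgood A FA) => HL _ _; apply: (sub_zero HL).
    * have [X FX [Xx Xy]] := both _ _ Ux Uy.
      by exists X => //; case: (Fgood X FX) => HL _ _; apply: (sub_add HL).
    * by exists X => //; case: (Fgood X FX) => HL _ _; apply: (sub_scale HL).
    * by exists X => //; case: (Fgood X FX) => HL _ _; apply: (sub_diff HL).
  + split=> [n|n x y Ux Uy|n a x [X FX Xx]|n x [X FX Xx]].
    * by exists A => //; case: (Fgood A FA) => _ HB _; apply: (sub_zero HB).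
    * have [X FX [Xx Xy]] := both _ _ Ux Uy.
      by exists X => //; case: (Fgood X FX) => _ HB _; apply: (sub_add HB).
    * by exists X => //; case: (Fgood X FX) => _ HB _; apply: (sub_scale HB).
    * by exists X => //; case: (Fgood X FX) => _ HB _; apply: (sub_diff HB).
  + move=> n l b Ul Ub; have [X FX [Xl Xb]] := both _ _ Ul Ub.
    by case: (Fgood X FX) => _ _; apply.
exists (inL X), (inB X); split=> // T1 T2 HT1 HT2 Ti ST1 ST2.
pose Y : set T := fun x => match x with
  | inl p => T1 _ (projT2 p) | inr p => T2 _ (projT2 p) end.
have YX : (Y `<=` X)%classic.
  by apply: Xmax => // -[[n l]|[n b]] /= Xx; [apply: ST1 | apply: ST2].
by split=> n x Tx; apply: YX.
Qed.

(* By maximality, a subcomplex of L (of B) not contained in S1 (in S2) has an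
   element outside S1 (S2) that lies in I + S1 + S2.  So the image of I is
   essential in (L + B)/(S1 + S2); being injective, it is everything. *)
Lemma exchange L B G I (i : chain_map I (dsum L B)) (sg : chain_map (dsum L B) G) :
  injective_complex I -> ses i sg ->
  exists (L1 B1 : complex R) (iL : chain_map L1 L) (rL : chain_map L L1)
      (iB : chain_map B1 B) (rB : chain_map B B1),
    [/\ forall n x, rL n (iL n x) = x, forall n x, rB n (iB n x) = x &
        cplx_iso G (dsum L1 B1)].
Proof.
move=> iI [im sge sgex].
have [S1 [S2 [HS1 HS2 ind Smax]]] := maximal_independent sg.
pose S n (v : dsum L B n) := S1 n v.1 /\ S2 n v.2.
have HS : is_subcomplex S.
  split=> [n|n x y [x1 x2] [y1 y2]|n a x [x1 x2]|n x [x1 x2]].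
  - by split; [apply: (sub_zero HS1) | apply: (sub_zero HS2)].
  - by split; [apply: (sub_add HS1) | apply: (sub_add HS2)].
  - by split; [apply: (sub_scale HS1) | apply: (sub_scale HS2)].
  - by split; [apply: (sub_diff HS1) | apply: (sub_diff HS2)].
have sg_indep n v : S n v -> sg n v = 0 -> v = 0.
  by case: v => l b [Sl Sb] /(ind n l b Sl Sb) [-> ->].
have maxL T : is_subcomplex T -> (exists n t, T n t /\ ~ S1 n t) ->
    exists n t, [/\ T n t, ~ S1 n t & exists2 s, S n s & sg n (t, 0) = sg n s].
  move=> HT [n0 [t0 [Tt0 St0]]]; apply: contrapT => no; apply: St0.
  have [||//|sub1 _] := Smax _ S2 (sum_subcomplex HS1 HT) HS2; last 1 first.
  - by apply: sub1; exists 0, t0; rewrite add0r; split=> //; apply: (sub_zero HS1).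
  - move=> n _ b [s [t [Ss Tt ->]]] Sb sg0.
    have [St|St] := pselect (S1 n t); first by apply: (ind n) => //; apply: (sub_add HS1).
    case: no; exists n, t; split=> //; exists (-%R (s, b) : dsum L B n).
      by split; [apply: (smodN (subcomplex_submodule HS1 n))
                |apply: (smodN (subcomplex_submodule HS2 n))].
    apply/eqP; rewrite linearN -addr_eq0 -linearD -[X in _ == X]sg0; apply/eqP.
    by congr (sg n _); congr pair; rewrite /= ?add0r // addrC.
  - move=> n s Ss; exists s, 0; rewrite addr0; split=> //; exact: (sub_zero HT).
have maxB T : is_subcomplex T -> (exists n t, T n t /\ ~ S2 n t) ->
    exists n t, [/\ T n t, ~ S2 n t & exists2 s, S n s & sg n (0, t) = sg n s].
  move=> HT [n0 [t0 [Tt0 St0]]]; apply: contrapT => no; apply: St0.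
  have [|//||_ sub2] := Smax S1 _ HS1 (sum_subcomplex HS2 HT); last 1 first.
  - by apply: sub2; exists 0, t0; rewrite add0r; split=> //; apply: (sub_zero HS2).
  - move=> n l _ Sl [s [t [Ss Tt ->]]] sg0.
    have [St|St] := pselect (S2 n t); first by apply: (ind n) => //; apply: (sub_add HS2).
    case: no; exists n, t; split=> //; exists (-%R (l, s) : dsum L B n).
      by split; [apply: (smodN (subcomplex_submodule HS1 n))
                |apply: (smodN (subcomplex_submodule HS2 n))].
    apply/eqP; rewrite linearN -addr_eq0 -linearD -[X in _ == X]sg0; apply/eqP.
    by congr (sg n _); congr pair; rewrite /= ?add0r // addrC.
  - move=> n s Ss; exists s, 0; rewrite addr0; split=> //; exact: (sub_zero HT).
have [Q [pr prP]] : exists (Q : complex R) (pr : chain_map (dsum L B) Q),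
    forall n v, pr n v = 0 <-> S n v.
  by exists _, (cquot_proj HS) => n v; apply: cquot_proj_ker.
(* I meets S trivially, so it embeds in the quotient by S and splits off it. The section [sh] of
   [sg] below has image ker(rho pr), a complement of I containing S; it remains to see that it
   equals S. *)
have [|rho rhoP] := iI _ _ (ccomp pr i) (cident I).
  apply: monoP => n x /prP Sx; apply: (mono0 im).
  by apply: sg_indep Sx _; apply: (ses0 sgex).
have [sh shP] : exists sh : chain_map G (dsum L B), forall n v,
    sh n (sg n v) = csub (cident _) (ccomp i (ccomp rho pr)) n v.
  by apply: (factor_coker sge sgex) => n x; have /= := rhoP n x => ->; apply: subrr.
have shS n v : S n v -> sh n (sg n v) = v.
  by move=> Sv; rewrite shP /=; have /prP -> := Sv; rewrite !linear0 addr0.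
have sgK n g : sg n (sh n g) = g.
  have [v <-] := sge n g; rewrite shP [csub _ _ n v]/(v - i n (rho n (pr n v))).
  by rewrite linearB (ses0 sgex) subr0.
pose Sig n g := exists v, S n v /\ g = sg n v.
have HSig : is_subcomplex Sig by apply: (map_subcomplex (cident _)).
have SigS n g : Sig n g -> S n (sh n g) by move=> [v [Sv ->]]; rewrite shS.
have Sig_split n g : Sig n (sg n ((sh n g).1, 0)) -> Sig n (sg n (0, (sh n g).2)) ->
    S n (sh n g).
  move=> Sl Sb; apply: SigS; rewrite -[g]sgK.
  suff -> : sh n g = ((sh n g).1, 0) + (0, (sh n g).2).
    by rewrite linearD; apply: (sub_add HSig).
  by rewrite {1}[sh n g]surjective_pairing; congr pair; rewrite /= ?addr0 ?add0r.
have SigL n l : S1 n l -> Sig n (sg n (l, 0)).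
  by move=> Sl; exists (l, 0); split=> //; split=> //; apply: (sub_zero HS2).
have SigB n b : S2 n b -> Sig n (sg n (0, b)).
  by move=> Sb; exists (0, b); split=> //; split=> //; apply: (sub_zero HS1).
(* The hypothesis says that the L-component lies in I + S. Maximality of S2 is applied to the
   B-components of all such values of [sh]: an offending one in I + S would give a value of [sh] in
   S. *)
have stepB n g : Sig n (sg n ((sh n g).1, 0)) -> S n (sh n g).
  move=> Sl; apply: (Sig_split) => //; apply: SigB; apply: contrapT => nSb.
  have HT := map_subcomplex (ccomp sg (ccomp (dsum_inl L B) (ccomp (cfst L B) sh)))
    (ccomp (csnd L B) sh) HSig.
  have [|n1 [_ [[g1 [/= Sg1 ->]] nS1 [s Ss sE]]]] := maxB _ HT.
    by exists n, (sh n g).2; split=> //; exists g.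
  by apply: nS1; have [] : S n1 (sh n1 g1) by apply: Sig_split => //; exists s.
have shS1 n g : S1 n (sh n g).1.
  apply: contrapT => nSl.
  have [||n1 [_ [[g1 ->] nS1 [s Ss sE]]]] := maxL (fun n l => exists g, l = (sh n g).1).
  - split=> [m|m _ _ [x ->] [y ->]|m a _ [x ->]|m _ [x ->]].
    + by exists 0; rewrite linear0.
    + by exists (x + y); rewrite linearD.
    + by exists (a *: x); rewrite linearZ.
    + by exists (cdiff m x); rewrite cmapP.
  - by exists n, (sh n g).1; split=> //; exists g.
  by apply: nS1; have [] : S n1 (sh n1 g1) by apply: stepB; exists s.
have shS2 n g : S2 n (sh n g).2.
  by have [] : S n (sh n g) by apply: stepB; apply: SigL.
have sub X (U : forall n, X n -> Prop) : is_subcomplex U ->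
    exists (Y : complex R) (iU : chain_map Y X), mono iU /\
      forall n x, U n x <-> exists y, iU n y = x.
  move=> HU; exists _, (csub_incl HU); split; first exact: csub_incl_mono.
  move=> n x; split=> [/csub_incl_exists //|[y <-]]; exact: csub_inclP.
have [L1 [iL [iLm iLP]]] := sub L S1 HS1.
have [B1 [iB [iBm iBP]]] := sub B S2 HS2.
have iLS n x : S1 n (iL n x) by apply/iLP; exists x.
have iBS n x : S2 n (iB n x) by apply/iBP; exists x.
have [a aP] : exists a : chain_map G L1, forall n g, iL n (a n g) = ccomp (cfst L B) sh n g.
  by apply: (lift_mono iLm) => n g; apply/iLP/shS1.
have [b bP] : exists b : chain_map G B1, forall n g, iB n (b n g) = ccomp (csnd L B) sh n g.
  by apply: (lift_mono iBm) => n g; apply/iBP/shS2.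
have shL n x : sh n (sg n (iL n x, 0)) = (iL n x, 0).
  by apply: shS; split; [apply: iLS | apply: (sub_zero HS2)].
have shB n x : sh n (sg n (0, iB n x)) = (0, iB n x).
  by apply: shS; split; [apply: (sub_zero HS1) | apply: iBS].
exists L1, B1, iL, (ccomp a (ccomp sg (dsum_inl L B))), iB,
  (ccomp b (ccomp sg (cpair (czero B L) (cident B)))); split.
- by move=> n x; apply: (iLm n); rewrite /= aP /= shL.
- by move=> n x; apply: (iBm n); rewrite /= bP /= shB.
exists (cpair a b), (ccomp sg (cpair (ccomp iL (cfst L1 B1)) (ccomp iB (csnd L1 B1)))).
split=> n x /=; first by rewrite aP bP /= -surjective_pairing sgK.
have e : sh n (sg n (iL n x.1, iB n x.2)) = (iL n x.1, iB n x.2) by apply: shS; split; [apply: iLS | apply: iBS].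
rewrite [x in RHS]surjective_pairing; congr pair.
  by apply: (iLm n); rewrite aP /= e.
by apply: (iBm n); rewrite bP /= e.
Qed.

(** The identity makes L a summand of G + I; B is its complement ker t, and [sg] is the isomorphism
    of L + B with G + I followed by the projection to G, hence has kernel I. *)
Lemma retract_complement L G I (lam : chain_map L G) (mu : chain_map G L)
    (al : chain_map L I) (be : chain_map I L) :
  (forall n x, x = mu n (lam n x) + be n (al n x)) ->
  exists (B : complex R) (ka : chain_map B (dsum G I)) (pi : chain_map (dsum G I) B)
      (sg : chain_map (dsum L B) G) (i : chain_map I (dsum L B)),
    [/\ forall n b, pi n (ka n b) = b,
        forall n b, mu n (ka n b).1 + be n (ka n b).2 = 0 & ses i sg].
Proof.
move=> E; pose s := cpair lam al; pose t := ccopair mu be.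
have tE n v : t n v = mu n v.1 + be n v.2 by [].
have tK n x : t n (s n x) = x by rewrite tE -E.
have [B [ka [kam kaex]]] := kernel_exists t.
have [pi piP0] : exists pi : chain_map (dsum G I) B, forall n v,
    ka n (pi n v) = csub (cident _) (ccomp s t) n v.
  apply: (lift_ker kam kaex) => n v.
  rewrite [csub _ _ n v]/(v - s n (t n v)).
  by rewrite linearB tK subrr.
have piP n v : ka n (pi n v) = v - s n (t n v) by exact: piP0.
have decomp n v : v = s n (t n v) + ka n (pi n v) by rewrite piP addrCA subrr addr0.
pose inI : chain_map I (dsum G I) := cpair (czero I G) (cident I).
pose sg := ccopair lam (ccomp (cfst G I) ka).
have sgE n l b : sg n (l, b) = (s n l + ka n b).1 by [].
exists B, ka, pi, sg, (cpair (ccomp t inI) (ccomp pi inI)); split.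
- move=> n b; apply: (kam n); by rewrite piP (ses0 kaex) linear0 subr0.
- by move=> n b; rewrite -tE (ses0 kaex).
split.
- apply: monoP => n x e0.
  have t0 : t n (inI n x) = 0 := congr1 fst e0.
  have p0 : pi n (inI n x) = 0 := congr1 snd e0.
  by have := decomp n (inI n x); rewrite t0 p0 !linear0 addr0 => -[].
- move=> n g; exists (t n (g, 0), pi n (g, 0)).
  by rewrite sgE -decomp.
- move=> n [l b]; split=> [|[x [<- <-]]]; last exact: esym (congr1 fst (decomp n (inI n x))).
  rewrite sgE => sb0; exists (s n l + ka n b).2.
  have e : inI n (s n l + ka n b).2 = s n l + ka n b.
    by rewrite [RHS]surjective_pairing sb0.
  have tl : t n (s n l + ka n b) = l by rewrite linearD tK (ses0 kaex) addr0.
  have pb : pi n (s n l + ka n b) = b.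
    by apply: (kam n); rewrite piP tl addrC addKr.
  by congr pair; [apply: etrans tl | apply: etrans pb]; rewrite -e.
Qed.
End Exchange.

(** * Gluing resolutions *)

Section Gluing.
Context {R : pzRingType}.
Implicit Types X Y A I : complex R.

Definition resolution_step (C : complex R -> Prop) X Y : Prop :=
  exists A (k : chain_map X A) (p : chain_map A Y),
    [/\ C A, ses k p & FP_precover p].

Lemma family_biresolved C (Z : int -> complex R) :
  (forall n, resolution_step C (Z n) (Z (n - 1))) ->
  biresolved C (fun X => exists n, X = Z n).
Proof.
move=> step _ [n ->]; split.
  have := step (n + 1); rewrite addrK => -[A [k [p [CA kp pp]]]].
  by exists (Z (n + 1)), A, k, p; split=> //; exists (n + 1).
have [A [k [p [CA kp pp]]]] := step n.
by exists A, (Z (n - 1)), k, p; split=> //; exists (n - 1).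
Qed.

Lemma biresolved_family C W L : biresolved C W -> W L ->
  exists Z : int -> complex R, Z 0 = L /\ forall n, resolution_step C (Z n) (Z (n - 1)).
Proof.
move=> bW WL; pose T := {X | W X}.
have [left leftP] : {f : T -> T & forall X : T, resolution_step C (sval (f X)) (sval X)}.
  apply: (@choice T T (fun X Y : T => resolution_step C (sval Y) (sval X))) => -[X WX]; have [[K [A [k [c [WK CA kc pc]]]]] _] := bW X WX.
  by exists (exist _ K WK), A, k, c.
have [right rightP] : {f : T -> T & forall X : T, resolution_step C (sval X) (sval (f X))}.
  apply: (@choice T T (fun X Y : T => resolution_step C (sval X) (sval Y))) => -[X WX]; have [_ [A [H [q [p [WH CA qp pp]]]]]] := bW X WX.
  by exists (exist _ H WH), A, q, p.
pose L0 : T := exist _ L WL.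
(* [Negz k] is -(k + 1), whence the k + 1 iterations to the right. *)
exists (fun n => match n with
  | Posz k => sval (iter k left L0) | Negz k => sval (iter k.+1 right L0) end).
split=> // -[[|k]|k].
- exact: rightP.
- by rewrite -addn1 PoszD addrK addn1; apply: leftP.
- have -> : Negz k - 1 = Negz k.+1 by rewrite !NegzE -opprD -PoszD addn1.
  exact: rightP.
Qed.

Lemma kernel_iso X Y Z (k : chain_map X Y) (d : chain_map Y Z) :
  mono k -> exact_at k d -> cplx_iso X (ker_complex d).
Proof.
move=> km kex.
have [f fP] : exists f : chain_map X (ker_complex d), forall n x,
    ckval d n (f n x) = k n x.
  apply: (lift_ker (@ckval_mono _ _ _ d) (@ckval_exact _ _ _ d)) => n x.
  exact: (ses0 kex).
have [g gP] : exists g : chain_map (ker_complex d) X, forall n x,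
    k n (g n x) = ckval d n x.
  by apply: (lift_ker km kex) => n x; apply: ckvalP.
exists f, g; split=> n x; first by apply: (km n); rewrite gP fP.
by apply: (@ckval_mono _ _ _ d n); rewrite fP gP.
Qed.

(** The short sequences are spliced: the differential is J_n -> Z_(n-1) -> J_(n-1), its cycles are
    the Z_n, and properness of the first map is exactness of Hom(A, -). *)
Lemma biresolved_Ding W L :
  biresolved (@injective_complex R) W -> W L -> Ding_injective L.
Proof.
move=> bW WL; have [Z [<- step]] := biresolved_family bW WL.
pose J n := projT1 (cid (step n)).
pose k n : chain_map (Z n) (J n) := projT1 (cid (projT2 (cid (step n)))).
pose p n : chain_map (J n) (Z (n - 1)) :=
  projT1 (cid (projT2 (cid (projT2 (cid (step n)))))).
have kpP n : [/\ injective_complex (J n), ses (k n) (p n) & FP_precover (p n)].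
  exact: projT2 (cid (projT2 (cid (projT2 (cid (step n)))))).
clearbody k p; have km n : mono (k n) by case: (kpP n) => _ [].
have pe n : epi (p n) by case: (kpP n) => _ [].
have ex n : exact_at (k n) (p n) by case: (kpP n) => _ [].
pose d n := ccomp (k (n - 1)) (p n).
have dK n m (x : J n m) : d (n - 1) m (d n m x) = 0.
  by rewrite /= (ses0 (ex (n - 1))) linear0.
have d0 n m (x : J n m) : d n m x = 0 <-> p n m x = 0.
  by split=> [/(mono0 (km (n - 1)))|/= ->]; rewrite ?linear0.
exists (DComplex dK); split=> [n m x|n|A FA n f fd|].
- rewrite /= d0; split=> [/ex [z <-]|[z <-]]; last exact: (ses0 (ex (n - 1))).
  by have [w <-] := pe n m z; exists w.
- by case: (kpP n).
- have [g gP] : exists g : chain_map A (Z (n - 1)), forall m a, k (n - 1) m (g m a) = f m a.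
    by apply: (lift_ker (km (n - 1)) (ex (n - 1))) => m a; apply/d0/fd.
  have [_ _ pp] := kpP n; have [h hP] := pp A g FA.
  by exists h => m a; rewrite /= hP gP.
- apply: kernel_iso (km 0) _ => m y; apply: iff_trans (ex 0 m y).
  exact: (d0 0).
Qed.

(** A map from A to the cycles is a map to E_(n-1) killed by the differential, so [Hom_exact] says
    precisely that E_n -> Z_(n-1) is proper. *)
Lemma cycles_step (E : dcomplex R) :
  dexact E -> (forall n, FP_injective (E n)) ->
  (forall A, FP_injective A -> Hom_exact A E) ->
  forall n, resolution_step (@FP_injective R) (cycles E n) (cycles E (n - 1)).
Proof.
move=> exE FE HE n.
have [p pP] : exists p : chain_map (E n) (cycles E (n - 1)), forall m x,
    ckval (ddiff E (n - 1)) m (p m x) = ddiff E n m x.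
  apply: (lift_ker (@ckval_mono _ _ _ (ddiff E (n - 1)))
                   (@ckval_exact _ _ _ (ddiff E (n - 1)))) => m x.
  exact: ddiffK.
exists (E n), (ckval (ddiff E n)), p; split=> //; first split.
- exact: ckval_mono.
- move=> m y; have /exE [x xP] := ckvalP y.
  by exists x; apply: (@ckval_mono _ _ _ (ddiff E (n - 1)) m); rewrite pP xP.
- move=> m x; apply: iff_trans (@ckval_exact _ _ _ (ddiff E n) m x).
  rewrite -pP; split=> [->|/(mono0 (@ckval_mono _ _ _ (ddiff E (n - 1))))//].
  by rewrite linear0.
move=> A f FA.
have [|g gP] := HE A FA n (ccomp (ckval (ddiff E (n - 1))) f).
  by move=> m a; apply: ckvalP.
exists g => m a; apply: (@ckval_mono _ _ _ (ddiff E (n - 1)) m).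
by rewrite pP gP.
Qed.
End Gluing.

Theorem proposition3p2 (R : pzRingType) (hR : left_coherent R)
    (G : complex R) (hG : weakly_Ding_injective G) :
  exists L B : complex R,
    [/\ Ding_injective L, FP_injective B & cplx_iso G (dsum L B)].
Proof.
have [E [exE FE HE [f0 [g0 [g0f0 f0g0]]]]] := hG.
pose W X := exists n, X = cycles E n.
have bW : biresolved (@FP_injective R) W by apply/family_biresolved/cycles_step.
have WE : W (cycles E 0) by exists 0.
have [L [I [F [lam [mu [al [be [del [rho [[iI FF] Lid Gid facL]]]]]]]]]] :=
  stable_splitting hR bW WE.
have [B [ka [pi [sg [i [piK kaE isg]]]]]] := retract_complement Lid.
have [L1 [B1 [iL [rL [iB [rB [rLK rBK [f [g [gf fg]]]]]]]]]] := exchange iI isg.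
have [_ [D [H [q [p [WH FD qp pp]]]]]] := bW _ WE.
have [_ [D' [H' [q' [p' [_ FD' qp' pp']]]]]] := bW _ WH.
have sL : stable_retract L1 (cycles E 0).
  apply: (retract_stable (i := ccomp g (dsum_inl L1 B1)) (r := ccomp (cfst L1 B1) f)).
  by move=> n x; rewrite /= fg.
exists L1, B1; split.
- apply: (biresolved_Ding (orth_biresolved hR bW)); split; last by exists (cycles E 0).
  apply: (stable_retract_orth hR qp pp FD qp' pp' FD' sL) => A a FA.
  apply: (@inj_factor_comp _ _ _ _ _ (ccomp iL a) (cident A) rL) => //.
    exact: facL.
  by move=> n x; rewrite /= rLK.
- apply: retract_FP rBK _.
  (* An element (g, x) of B has mu g + be x = 0, so g = lam(mu g) + rho(del g) = rho(del g) - lam(be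
     x) is recovered from (del g, x): B is a summand of F + I. *)
  apply: (@retract_FP _ _ (dsum F I)
    (cpair (ccomp del (ccomp (cfst _ _) ka)) (ccomp (csnd _ _) ka))
    (ccomp pi (cpair (csub (ccomp rho (cfst F I)) (ccomp lam (ccomp be (csnd F I))))
                     (csnd F I)))).
    move=> n b; rewrite -[RHS]piK /=; congr (pi n _).
    rewrite [RHS]surjective_pairing; congr pair.
    rewrite {2}[(ka n b).1]Gid addrC; congr (_ + _).
    by rewrite -linearN; congr (lam n _); apply/eqP; rewrite eq_sym -addr_eq0 kaE.
  by apply: dsum_FP => //; apply: injective_FP.
- exists (ccomp f f0), (ccomp g0 g); split=> n x /=; first by rewrite gf g0f0.
  by rewrite f0g0 fg.
Qed.
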